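(* Let $R$ be a ring and $(P,Q,\psi)$ an $R$-system that satisfies condition (FS). Let $(S,T,\sigma,B)$ be a covariant representation of $(P,Q,\psi)$ and let $\omega=(I,J)$ be a $T$-pair of $(P,Q,\psi)$. Then: (1) If there is a ring homomorphism $\eta:\mathcal{O}_{({}_IP,Q_I,\psi_I)}(J_I)\to B$ such that $\eta\circ\iota^\omega_R=\sigma$, $\eta\circ\iota^\omega_Q=T$ and $\eta\circ\iota^\omega_P=S$, then $I\subseteq I_{(S,T,\sigma,B)}$ and $J\subseteq J_{(S,T,\sigma,B)}$. (2) If $I\subseteq I_{(S,T,\sigma,B)}$ and $J\subseteq J_{(S,T,\sigma,B)}$, then there exists a unique ring homomorphism $\eta^\omega_{(S,T,\sigma,B)}:\mathcal{O}_{({}_IP,Q_I,\psi_I)}(J_I)\to B$ such that $\eta^\omega_{(S,T,\sigma,B)}\circ\iota^\omega_R=\sigma$, $\eta^\omega_{(S,T,\sigma,B)}\circ\iota^\omega_Q=T$ and $\eta^\omega_{(S,T,\sigma,B)}\circ\iota^\omega_P=S$. (3) If $I\subseteq I_{(S,T,\sigma,B)}$ and $J\subseteq J_{(S,T,\sigma,B)}$, then $\eta^\omega_{(S,T,\sigma,B)}$ is an isomorphism if and only if $(S,T,\sigma,B)$ is a surjective and graded representation and $\omega=\omega_{(S,T,\sigma,B)}$.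
   Context: Rings are associative, not necessarily unital. For $R$-bimodules $P,Q$, $P\otimes Q$ is the $R$-balanced tensor product. ''Linear'' means additive. An $R$-system is a triple $(P,Q,\psi)$ where $P,Q$ are $R$-bimodules and $\psi:P\otimes Q\to R$ is an $R$-bimodule homomorphism. A covariant representation of $(P,Q,\psi)$ is a quadruple $(S,T,\sigma,B)$ where $B$ is a ring, $S:P\to B$ and $T:Q\to B$ are linear maps, $\sigma:R\to B$ is a ring homomorphism, and $S(pr)=S(p)\sigma(r)$, $S(rp)=\sigma(r)S(p)$, $T(qr)=T(q)\sigma(r)$, $T(rq)=\sigma(r)T(q)$, $\sigma(\psi(p\otimes q))=S(p)T(q)$ for all $r\in R,p\in P,q\in Q$. It is surjective if $B$ is generated as a ring by $\sigma(R)\cup T(Q)\cup S(P)$, injective if $\sigma$ is injective. A surjective covariant representation is graded if $B$ has a $\mathbb{Z}$-grading $\bigoplus_{n}B^{(n)}$ with $\sigma(R)\subseteq B^{(0)}$, $T(Q)\subseteq B^{(1)}$, $S(P)\subseteq B^{(-1)}$. The Toeplitz representation $(\iota_P,\iota_Q,\iota_R,\mathcal{T}_{(P,Q,\psi)})$ is the (up to isomorphism unique) surjective covariant representation such that for every covariant representation $(S,T,\sigma,B)$ there is a unique ring homomorphism $\eta:\mathcal{T}_{(P,Q,\psi)}\to B$ with $\eta\circ\iota_R=\sigma$, $\eta\circ\iota_Q=T$, $\eta\circ\iota_P=S$; it exists and is injective. For $p\in P,q\in Q$: $\theta_{q,p}:Q\to Q$, $x\mapsto q\psi(p\otimes x)$,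 and $\theta_{p,q}:P\to P$, $y\mapsto\psi(y\otimes q)p$. $\mathcal{F}_P(Q)$ is the additive span of all $\theta_{q,p}$, $\mathcal{F}_Q(P)$ the additive span of all $\theta_{p,q}$. Condition (FS): for all finite sets $\{q_1,\dots,q_n\}\subseteq Q$, $\{p_1,\dots,p_m\}\subseteq P$ there exist $\Theta\in\mathcal{F}_P(Q)$ and $\Omega\in\mathcal{F}_Q(P)$ with $\Theta(q_i)=q_i$ and $\Omega(p_j)=p_j$ for all $i,j$. $\Delta:R\to\operatorname{End}(Q_R)$ is the ring homomorphism $\Delta(r)(q)=rq$. Under (FS), every covariant representation $(S,T,\sigma,B)$ induces a unique ring homomorphism $\pi_{T,S}:\mathcal{F}_P(Q)\to B$ with $\pi_{T,S}(\theta_{q,p})=T(q)S(p)$; put $\pi=\pi_{\iota_Q,\iota_P}$. A two-sided ideal $J$ of $R$ is $\psi$-compatible if $J\subseteq\Delta^{-1}(\mathcal{F}_P(Q))$; a $\psi$-compatible $J$ is faithful if $J\cap\ker\Delta=\{0\}$. For $\psi$-compatible $J$, $\mathcal{T}(J)$ is the two-sided ideal of $\mathcal{T}_{(P,Q,\psi)}$ generated by $\{\iota_R(x)-\pi(\Delta(x)):x\in J\}$, $\mathcal{O}_{(P,Q,\psi)}(J):=\mathcal{T}_{(P,Q,\psi)}/\mathcal{T}(J)$ with quotient map $\rho_J$, and $\iota_R^J=\rho_J\circ\iota_R$, $\iota_Q^J=\rho_J\circ\iota_Q$, $\iota_P^J=\rho_J\circ\iota_P$. A two-sided ideal $I$ of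 $R$ is $\psi$-invariant if $\psi(p\otimes xq)\in I$ for all $p\in P,q\in Q,x\in I$. With $QI=\operatorname{span}\{qx\}$ and $IP=\operatorname{span}\{xp\}$ ($q\in Q$, $p\in P$, $x\in I$), put $R_I=R/I$, $Q_I=Q/QI$, ${}_IP=P/IP$, with quotient maps all denoted $\wp_I$. Under (FS) and $\psi$-invariance of $I$, $Q_I$ and ${}_IP$ are $R_I$-bimodules and $({}_IP,Q_I,\psi_I)$ with $\psi_I(\wp_I(p)\otimes\wp_I(q))=\wp_I(\psi(p\otimes q))$ is an $R_I$-system satisfying (FS). A $T$-pair of $(P,Q,\psi)$ is a pair $\omega=(I,J)$ of two-sided ideals of $R$ with $I\subseteq J$, $I$ $\psi$-invariant, and $J_I:=\wp_I(J)$ a faithful $\psi_I$-compatible two-sided ideal of $R_I$. For a $T$-pair $\omega=(I,J)$ put $\iota_R^\omega=\iota_{R_I}^{J_I}\circ\wp_I$, $\iota_Q^\omega=\iota_{Q_I}^{J_I}\circ\wp_I$, $\iota_P^\omega=\iota_{{}_IP}^{J_I}\circ\wp_I$, with values in $\mathcal{O}_{({}_IP,Q_I,\psi_I)}(J_I)$. For a covariant representation $(S,T,\sigma,B)$ of $(P,Q,\psi)$: $I_{(S,T,\sigma,B)}:=\ker\sigma$, $J_{(S,T,\sigma,B)}:=\{r\in R:\sigma(r)\in\pi_{T,S}(\mathcal{F}_P(Q))\}$ and $\omega_{(S,T,\sigma,B)}:=(I_{(S,T,\sigma,B)},J_{(S,T,\sigma,B)})$. *)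

(* Defs.v *)
From HB Require Import structures.
From mathcomp Require Import all_boot ssralg ssrint ring_quotient.
From mathcomp Require Import boolp classical_sets functions cardinality fsbigop.
From mathcomp Require Import freeg.

Set Implicit Arguments.
Unset Strict Implicit.
Unset Printing Implicit Defensive.
Import GRing.Theory.

Local Open Scope classical_set_scope.
Local Open Scope ring_scope.
Local Notation "x * y" := (monoid.mul x y) : ring_scope.

(* The rings of ssralg are unital: a ring that need not have a unit is a      *)
(* zmodType that is also a semigroupType, with distributivity.                *)

HB.mixin Record isDistributive R of GRing.Zmodule R & Semigroup R := {
  rngMDl : left_distributive (@monoid.mul R) (@GRing.add R);
  rngMDr : right_distributive (@monoid.mul R) (@GRing.add R)
}.

#[short(type="rngType")]
HB.structure Definition Rng :=
  {R of isDistributive R & GRing.Zmodule R & Semigroup R}.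

HB.factory Record Zmodule_isRng R of GRing.Zmodule R := {
  rmul : R -> R -> R;
  rmulA : associative rmul;
  rmulDl : left_distributive rmul +%R;
  rmulDr : right_distributive rmul +%R
}.
HB.builders Context R of Zmodule_isRng R.
HB.instance Definition _ := isSemigroup.Build R rmulA.
HB.instance Definition _ := isDistributive.Build R rmulDl rmulDr.
HB.end.

HB.structure Definition RngMorphism (R S : rngType) :=
  {f of GRing.isNmodMorphism R S f & monoid.isMultiplicative R S f}.
Notation "{ 'rngmorphism' R -> S }" := (RngMorphism.type R%type S%type)
  (at level 0, R at level 98, S at level 99,
   format "{ 'rngmorphism'  R  ->  S }") : type_scope.

Section RngTheory.
Variable R : rngType.
Implicit Types x y z : R.

Lemma rngM0 x : x * 0 = 0.
Proof. by apply: (@addrI _ (x * 0)); rewrite -rngMDr !addr0. Qed.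
Lemma rng0M x : 0 * x = 0.
Proof. by apply: (@addrI _ (0 * x)); rewrite -rngMDl !addr0. Qed.
Lemma rngMN x y : x * - y = - (x * y).
Proof. by apply: (@addrI _ (x * y)); rewrite -rngMDr !subrr rngM0. Qed.
Lemma rngNM x y : - x * y = - (x * y).
Proof. by apply: (@addrI _ (x * y)); rewrite -rngMDl !subrr rng0M. Qed.
Lemma rngMBr x y z : x * (y - z) = x * y - x * z.
Proof. by rewrite rngMDr rngMN. Qed.
Lemma rngMBl x y z : (x - y) * z = x * z - y * z.
Proof. by rewrite rngMDl rngNM. Qed.
Lemma rng_sumr I (s : seq I) (F : I -> R) x :
  x * (\sum_(i <- s) F i) = \sum_(i <- s) x * F i.
Proof. exact: (big_morph _ (rngMDr x) (rngM0 x)). Qed.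
Lemma rng_suml I (s : seq I) (F : I -> R) x :
  (\sum_(i <- s) F i) * x = \sum_(i <- s) F i * x.
Proof.
by apply: (big_morph (fun y => y * x)); [move=> y z; exact: rngMDl|exact: rng0M].
Qed.

End RngTheory.

Lemma rngmorphismP (R S : rngType) (f g : {rngmorphism R -> S}) :
  f =1 g -> f = g.
Proof.
case: f g => f [[fD] [fM]] [g [[gD] [gM]]] /= /funext fg.
by case: _ / fg in gD gM *; rewrite (Prop_irrelevance fM gM)
  (_ : fD = gD) //; case: fD gD => ? ? [? ?]; congr pair; exact: Prop_irrelevance.
Qed.

Section RngComp.
Variables (R S T : rngType) (f : {rngmorphism S -> T}) (g : {rngmorphism R -> S}).
Lemma rng_compM : {morph f \o g : x y / x * y}.
Proof. by move=> x y /=; rewrite !gmulfM. Qed.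
HB.instance Definition _ := monoid.isMultiplicative.Build R T (f \o g) rng_compM.
End RngComp.

Definition is_subgroup (V : zmodType) (G : set V) : Prop :=
  G 0 /\ forall x y, G x -> G y -> G (x - y).

Definition zspan (V : zmodType) (A : set V) : set V := smallest (@is_subgroup V) A.

Section Span.
Variables (V : zmodType) (A : set V).

Lemma zspan_subgroup : is_subgroup (zspan A).
Proof.
split=> [|x y Ax Ay]; first by move=> G [[G0 _] _].
move=> G GA.
by have [[_ GB] _] := GA; apply: GB; [exact: Ax|exact: Ay].
Qed.

Lemma zspan_mem : A `<=` zspan A. Proof. exact: sub_gen_smallest. Qed.

Lemma zspan_sub (G : set V) : is_subgroup G -> A `<=` G -> zspan A `<=` G.
Proof. exact: smallest_sub. Qed.

Lemma zspan0 : zspan A 0. Proof. by case: zspan_subgroup. Qed.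
Lemma zspanB x y : zspan A x -> zspan A y -> zspan A (x - y).
Proof. by case: zspan_subgroup => _; apply. Qed.
Lemma zspanN x : zspan A x -> zspan A (- x).
Proof. by rewrite -sub0r; apply: zspanB; apply: zspan0. Qed.
Lemma zspanD x y : zspan A x -> zspan A y -> zspan A (x + y).
Proof. by move=> Ax Ay; rewrite -[y]opprK; apply: zspanB => //; exact: zspanN. Qed.

Lemma zspan_id : is_subgroup A -> zspan A = A.
Proof. exact: smallest_id. Qed.

Definition zspan_pred : {pred V} := fun x => `[< zspan A x >].

Lemma zspan_pred_closed : zmod_closed zspan_pred.
Proof.
split=> [|x y]; rewrite !unfold_in; first by apply/asboolP; exact: zspan0.
by move=> /asboolP Ax /asboolP Ay; apply/asboolP; exact: zspanB.
Qed.
HB.instance Definition _ := GRing.isZmodClosed.Build V zspan_pred zspan_pred_closed.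

(* V modulo the subgroup generated by A. *)
Definition quotz : zmodType := Quotient.quot zspan_pred.

Definition quotmap : {additive V -> quotz} := \pi_(quotz)%qT.

Lemma quotmapP x y : quotmap x = quotmap y <-> zspan A (x - y).
Proof.
split=> [/eqP|xy]; last apply/eqP.
  by rewrite /= -Quotient.idealrBE unfold_in => /asboolP.
by rewrite /= -Quotient.idealrBE unfold_in; apply/asboolP.
Qed.

Lemma quotmap_eq0 x : quotmap x = 0 <-> zspan A x.
Proof. by rewrite -(raddf0 quotmap) quotmapP subr0. Qed.

Definition quotrepr (a : quotz) : V := repr a.
Lemma quotreprK : cancel quotrepr quotmap. Proof. exact: reprK. Qed.

Lemma quotmap_surj a : exists x, quotmap x = a.
Proof. by exists (quotrepr a); rewrite quotreprK. Qed.

Lemma quotreprP x : zspan A (quotrepr (quotmap x) - x).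
Proof. by apply/quotmapP; rewrite quotreprK. Qed.

End Span.

(* The proof argument is only there for the additive instance to be inferred. *)
Definition quotlift (V W : zmodType) (A : set V) (f : {additive V -> W})
  (_ : forall a, A a -> f a = 0) (a : quotz A) : W := f (quotrepr a).

Section QuotLift.
Variables (V W : zmodType) (A : set V) (f : {additive V -> W}).
Hypothesis fA : forall a, A a -> f a = 0.
Local Notation quotlift := (quotlift fA).

Lemma quotlift_ker x : zspan A x -> f x = 0.
Proof.
suff : zspan A `<=` [set x | f x = 0] by apply.
apply: zspan_sub => //=; split=> [|y z /= fy fz]; first exact: raddf0.
by rewrite raddfB fy fz subr0.
Qed.

Lemma quotliftE x : quotlift (quotmap A x) = f x.
Proof.
apply/eqP; rewrite -subr_eq0 -raddfB; apply/eqP/quotlift_ker.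
exact: quotreprP.
Qed.

Lemma quotlift_zmod : zmod_morphism quotlift.
Proof.
move=> a b; have [x <-] := quotmap_surj a; have [y <-] := quotmap_surj b.
by rewrite -raddfB !quotliftE raddfB.
Qed.

HB.instance Definition _ :=
  GRing.isZmodMorphism.Build (quotz A) W quotlift quotlift_zmod.

End QuotLift.

Definition is_ideal (R : rngType) (I : set R) : Prop :=
  is_subgroup I /\ forall r x, I x -> I (r * x) /\ I (x * r).

Record rideal (R : rngType) := RIdeal {
  ideal_set :> set R;
  idealP : is_ideal ideal_set
}.

Section Ideal.
Variable R : rngType.

Lemma ideal0 (I : rideal R) : ideal_set I 0. Proof. by case: (idealP I) => -[]. Qed.
Lemma idealB (I : rideal R) x y : ideal_set I x -> ideal_set I y -> ideal_set I (x - y).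
Proof. by case: (idealP I) => -[_ +] _; apply. Qed.
Lemma idealMl (I : rideal R) r x : ideal_set I x -> ideal_set I (r * x).
Proof. by move=> Ix; case: (idealP I) => _ /(_ r x Ix)[]. Qed.
Lemma idealMr (I : rideal R) r x : ideal_set I x -> ideal_set I (x * r).
Proof. by move=> Ix; case: (idealP I) => _ /(_ r x Ix)[]. Qed.
Lemma zspan_ideal (I : rideal R) : zspan I = I :> set R.
Proof. by apply: zspan_id; case: (idealP I). Qed.

Lemma smallest_ideal (A : set R) : is_ideal (smallest (@is_ideal R) A).
Proof.
split; first split=> [G [[[]]]//|x y Ax Ay G GA].
  by have [[[_ GB] _] _] := GA; apply: GB; [exact: Ax|exact: Ay].
move=> r x Ax; split=> G GA; have [[_ GM] _] := GA;
  by have [] := GM r x (Ax _ GA).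
Qed.

Definition ideal_gen (A : set R) : rideal R := RIdeal (smallest_ideal A).

End Ideal.

Section QuotientRing.
Variables (R : rngType) (I : rideal R).

Definition rquot : Type := quotz I.
HB.instance Definition _ := GRing.Zmodule.on rquot.

Let pi : R -> rquot := quotmap I.

Let piP x y : pi x = pi y <-> ideal_set I (x - y).
Proof. by rewrite /pi quotmapP zspan_ideal. Qed.

Definition rquot_mul (a b : rquot) : rquot := pi (quotrepr a * quotrepr b).

Let pi_mul x y : rquot_mul (pi x) (pi y) = pi (x * y).
Proof.
have [rx ry] := (quotreprP (A := I) x, quotreprP (A := I) y).
rewrite zspan_ideal in rx ry; apply/piP.
set x' := quotrepr _; set y' := quotrepr _.
rewrite -(subrKA (x' * y)) -rngMBr -rngMBl -[_ * y]opprK.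
apply: idealB; first exact: idealMl.
by rewrite -[- _]sub0r; apply/idealB/idealMr => //; apply: ideal0.
Qed.

Let pi_surj a : exists x, pi x = a. Proof. exact: quotmap_surj. Qed.

Let piD x y : pi (x + y) = pi x + pi y. Proof. exact: raddfD. Qed.

Let rquot_mulA : associative rquot_mul.
Proof.
move=> a b c; have [x <-] := pi_surj a; have [y <-] := pi_surj b.
by have [z <-] := pi_surj c; rewrite !pi_mul mulgA.
Qed.
Let rquot_mulDl : left_distributive rquot_mul +%R.
Proof.
move=> a b c; have [x <-] := pi_surj a; have [y <-] := pi_surj b.
by have [z <-] := pi_surj c; rewrite -piD !pi_mul -piD rngMDl.
Qed.
Let rquot_mulDr : right_distributive rquot_mul +%R.
Proof.
move=> a b c; have [x <-] := pi_surj a; have [y <-] := pi_surj b.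
by have [z <-] := pi_surj c; rewrite -piD !pi_mul -piD rngMDr.
Qed.
HB.instance Definition _ :=
  Zmodule_isRng.Build rquot rquot_mulA rquot_mulDl rquot_mulDr.

Definition rproj : R -> rquot := quotmap I.
HB.instance Definition _ :=
  GRing.isZmodMorphism.Build R rquot rproj (raddfB (quotmap I)).
Let rproj_mul : {morph rproj : x y / x * y}.
Proof. by move=> x y; apply: esym; exact: pi_mul. Qed.
HB.instance Definition _ := monoid.isMultiplicative.Build R rquot rproj rproj_mul.

Lemma rprojP x y : rproj x = rproj y <-> ideal_set I (x - y). Proof. exact: piP. Qed.
Lemma rproj_eq0 x : rproj x = 0 <-> ideal_set I x.
Proof. by rewrite -(raddf0 rproj) rprojP subr0. Qed.
Lemma rproj_surj a : exists x, rproj x = a. Proof. exact: quotmap_surj. Qed.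

Lemma rproj_image_ideal (J : rideal R) : is_ideal (rproj @` J).
Proof.
split; first split=> [|_ _ [x Jx <-] [y Jy <-]].
- by exists 0; [exact: ideal0|exact: raddf0].
- by exists (x - y); [exact: idealB|exact: raddfB].
move=> a _ [x Jx <-]; have [r <-] := rproj_surj a; rewrite -!gmulfM.
by split; [exists (r * x)|exists (x * r)] => //; [exact: idealMl|exact: idealMr].
Qed.

Definition rproj_ideal (J : rideal R) : rideal rquot := RIdeal (rproj_image_ideal J).

End QuotientRing.

HB.mixin Record Zmodule_isBimod (R : rngType) M of GRing.Zmodule M := {
  lact : R -> M -> M;
  ract : M -> R -> M;
  lactDl : forall r s m, lact (r + s) m = lact r m + lact s m;
  lactDr : forall r m n, lact r (m + n) = lact r m + lact r n;
  lactM : forall r s m, lact (r * s) m = lact r (lact s m);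
  ractDl : forall m n r, ract (m + n) r = ract m r + ract n r;
  ractDr : forall m r s, ract m (r + s) = ract m r + ract m s;
  ractM : forall m r s, ract m (r * s) = ract (ract m r) s;
  lractA : forall r m s, lact r (ract m s) = ract (lact r m) s
}.

#[short(type="bimodType")]
HB.structure Definition Bimod (R : rngType) :=
  {M of Zmodule_isBimod R M & GRing.Zmodule M}.

Notation "r *> m" := (lact r m) (at level 40, left associativity) : ring_scope.
Notation "m <* r" := (ract m r) (at level 40, left associativity) : ring_scope.

Section BimodTheory.
Variables (R : rngType) (M : bimodType R).
Implicit Types (r s : R) (m n : M).

Lemma lact0r r : r *> (0 : M) = 0.
Proof. by apply: (@addrI _ (r *> 0)); rewrite -lactDr !addr0. Qed.
Lemma lact0l m : (0 : R) *> m = 0.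
Proof. by apply: (@addrI _ ((0 : R) *> m)); rewrite -lactDl !addr0. Qed.
Lemma lactNr r m : r *> (- m) = - (r *> m).
Proof. by apply: (@addrI _ (r *> m)); rewrite -lactDr !subrr lact0r. Qed.
Lemma lactNl r m : (- r) *> m = - (r *> m).
Proof. by apply: (@addrI _ (r *> m)); rewrite -lactDl !subrr lact0l. Qed.
Lemma lactBr r m n : r *> (m - n) = r *> m - r *> n.
Proof. by rewrite lactDr lactNr. Qed.
Lemma lactBl r s m : (r - s) *> m = r *> m - s *> m.
Proof. by rewrite lactDl lactNl. Qed.
Lemma ract0r m : m <* (0 : R) = 0.
Proof. by apply: (@addrI _ (m <* (0 : R))); rewrite -ractDr !addr0. Qed.
Lemma ract0l r : (0 : M) <* r = 0.
Proof. by apply: (@addrI _ ((0 : M) <* r)); rewrite -ractDl !addr0. Qed.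
Lemma ractNr m r : m <* (- r) = - (m <* r).
Proof. by apply: (@addrI _ (m <* r)); rewrite -ractDr !subrr ract0r. Qed.
Lemma ractNl m r : (- m) <* r = - (m <* r).
Proof. by apply: (@addrI _ (m <* r)); rewrite -ractDl !subrr ract0l. Qed.
Lemma ractBr m r s : m <* (r - s) = m <* r - m <* s.
Proof. by rewrite ractDr ractNr. Qed.
Lemma ractBl m n r : (m - n) <* r = m <* r - n <* r.
Proof. by rewrite ractDl ractNl. Qed.

End BimodTheory.

(* The condition for the quotient of the R-bimodule M by the span N of A to   *)
(* be an R/I-bimodule: N is a sub-bimodule, and both I M and M I lie in N.    *)
Definition bimod_compat (R : rngType) (I : rideal R) (M : bimodType R) (A : set M) :=
  [/\ forall r m, A m -> zspan A (r *> m), forall r m, A m -> zspan A (m <* r),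
      forall x m, ideal_set I x -> zspan A (x *> m) &
      forall x m, ideal_set I x -> zspan A (m <* x)].

(* The proof argument is only there for the bimodule instance to be inferred. *)
Definition bquot (R : rngType) (I : rideal R) (M : bimodType R) (A : set M)
  (_ : bimod_compat I A) : Type := quotz A.

Section QuotientBimodule.
Variables (R : rngType) (I : rideal R) (M : bimodType R) (A : set M).
Hypothesis AP : bimod_compat I A.
Local Notation bquot := (bquot AP).

HB.instance Definition _ := GRing.Zmodule.on bquot.

Definition bproj : M -> bquot := quotmap A.
HB.instance Definition _ :=
  GRing.isZmodMorphism.Build M bquot bproj (raddfB (quotmap A)).

Lemma bprojP m n : bproj m = bproj n <-> zspan A (m - n).
Proof. exact: quotmapP. Qed.
Lemma bproj_eq0 m : bproj m = 0 <-> zspan A m.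
Proof. exact: quotmap_eq0. Qed.
Lemma bproj_surj a : exists m, bproj m = a. Proof. exact: quotmap_surj. Qed.

Let lact_span r m : zspan A m -> zspan A (r *> m).
Proof.
suff : zspan A `<=` [set m | zspan A (r *> m)] by apply.
have [Al _ _ _] := AP; apply: zspan_sub => [|n An]; last exact: Al.
split=> /= [|x y Ax Ay].
  by rewrite lact0r; exact: zspan0.
by rewrite lactBr; exact: zspanB.
Qed.
Let ract_span r m : zspan A m -> zspan A (m <* r).
Proof.
suff : zspan A `<=` [set m | zspan A (m <* r)] by apply.
have [_ Ar _ _] := AP; apply: zspan_sub => [|n An]; last exact: Ar.
split=> /= [|x y Ax Ay].
  by rewrite ract0l; exact: zspan0.
by rewrite ractBl; exact: zspanB.
Qed.

Definition bquot_lact (a : rquot I) (b : bquot) : bquot :=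
  bproj (quotrepr (a : quotz I) *> quotrepr (b : quotz A)).
Definition bquot_ract (b : bquot) (a : rquot I) : bquot :=
  bproj (quotrepr (b : quotz A) <* quotrepr (a : quotz I)).

Let lactE r m : bquot_lact (rproj I r) (bproj m) = bproj (r *> m).
Proof.
apply/bprojP; rewrite -(subrKA (quotrepr (rproj I r : quotz I) *> m)).
rewrite -lactBr -lactBl; have [_ _ Il _] := AP; apply: zspanD.
  by apply: lact_span; exact: quotreprP.
by apply: Il; have := quotreprP (A := I) r; rewrite zspan_ideal.
Qed.
Let ractE m r : bquot_ract (bproj m) (rproj I r) = bproj (m <* r).
Proof.
apply/bprojP; rewrite -(subrKA (m <* quotrepr (rproj I r : quotz I))).
rewrite -ractBr -ractBl; have [_ _ _ Ir] := AP; apply: zspanD.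
  by apply: ract_span; exact: quotreprP.
by apply: Ir; have := quotreprP (A := I) r; rewrite zspan_ideal.
Qed.

Let bquotDl r s m : bquot_lact (r + s) m = bquot_lact r m + bquot_lact s m.
Proof.
have [{}r <-] := rproj_surj r; have [{}s <-] := rproj_surj s.
by have [{}m <-] := bproj_surj m; rewrite -raddfD !lactE lactDl raddfD.
Qed.
Let bquotDr r m n : bquot_lact r (m + n) = bquot_lact r m + bquot_lact r n.
Proof.
have [{}r <-] := rproj_surj r; have [{}n <-] := bproj_surj n.
by have [{}m <-] := bproj_surj m; rewrite -raddfD !lactE lactDr raddfD.
Qed.
Let bquotM r s m : bquot_lact (r * s) m = bquot_lact r (bquot_lact s m).
Proof.
have [{}r <-] := rproj_surj r; have [{}s <-] := rproj_surj s.
by have [{}m <-] := bproj_surj m; rewrite -gmulfM !lactE lactM.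
Qed.
Let bquotrDl m n r : bquot_ract (m + n) r = bquot_ract m r + bquot_ract n r.
Proof.
have [{}r <-] := rproj_surj r; have [{}n <-] := bproj_surj n.
by have [{}m <-] := bproj_surj m; rewrite -raddfD !ractE ractDl raddfD.
Qed.
Let bquotrDr m r s : bquot_ract m (r + s) = bquot_ract m r + bquot_ract m s.
Proof.
have [{}r <-] := rproj_surj r; have [{}s <-] := rproj_surj s.
by have [{}m <-] := bproj_surj m; rewrite -raddfD !ractE ractDr raddfD.
Qed.
Let bquotrM m r s : bquot_ract m (r * s) = bquot_ract (bquot_ract m r) s.
Proof.
have [{}r <-] := rproj_surj r; have [{}s <-] := rproj_surj s.
by have [{}m <-] := bproj_surj m; rewrite -gmulfM !ractE ractM.
Qed.
Let bquotA r m s : bquot_lact r (bquot_ract m s) = bquot_ract (bquot_lact r m) s.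
Proof.
have [{}r <-] := rproj_surj r; have [{}s <-] := rproj_surj s.
by have [{}m <-] := bproj_surj m; rewrite !(lactE, ractE) lractA.
Qed.
HB.instance Definition _ := Zmodule_isBimod.Build (rquot I) bquot
  bquotDl bquotDr bquotM bquotrDl bquotrDr bquotrM bquotA.

Lemma bprojl r m : rproj I r *> bproj m = bproj (r *> m).
Proof. exact: lactE. Qed.
Lemma bprojr r m : bproj m <* rproj I r = bproj (m <* r).
Proof. exact: ractE. Qed.

End QuotientBimodule.

Section Tensor.
Variables (R : rngType) (P Q : bimodType R).

(* The R-balanced tensor product is the free abelian group on P x Q modulo    *)
(* the relations of biadditivity and of R-balancedness.                       *)
Definition tensor_rel : set {freeg (P * Q)} :=
  [set z | exists p p' q, z = << (p + p', q) >> - << (p, q) >> - << (p', q) >>] `|`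
  [set z | exists p q q', z = << (p, q + q') >> - << (p, q) >> - << (p, q') >>] `|`
  [set z | exists p r q, z = << (p <* r, q) >> - << (p, r *> q) >>].

Definition tensor : Type := quotz tensor_rel.
HB.instance Definition _ := GRing.Zmodule.on tensor.

Definition tens (p : P) (q : Q) : tensor := quotmap tensor_rel << (p, q) >>.

End Tensor.

Notation "p \ox q" := (tens p q) (at level 40, left associativity) : ring_scope.

Section TensorTheory.
Variables (R : rngType) (P Q : bimodType R).

Lemma tensDl (p p' : P) (q : Q) : (p + p') \ox q = p \ox q + p' \ox q.
Proof.
apply/eqP; rewrite -subr_eq0 opprD addrA -!raddfB; apply/eqP/quotmap_eq0.
by apply: zspan_mem; left; left; exists p, p', q.
Qed.
Lemma tensDr (p : P) (q q' : Q) : p \ox (q + q') = p \ox q + p \ox q'.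
Proof.
apply/eqP; rewrite -subr_eq0 opprD addrA -!raddfB; apply/eqP/quotmap_eq0.
by apply: zspan_mem; left; right; exists p, q, q'.
Qed.
Lemma tens_balanced (p : P) r (q : Q) : (p <* r) \ox q = p \ox (r *> q).
Proof. by apply/quotmapP; apply: zspan_mem; right; exists p, r, q. Qed.

Lemma tensor_ind (K : tensor P Q -> Prop) :
  K 0 -> (forall x y, K x -> K y -> K (x - y)) ->
  (forall p q, K (p \ox q)) -> forall x, K x.
Proof.
move=> K0 KB Kt x.
have KN y : K y -> K (- y) by move=> Ky; rewrite -sub0r; exact: KB.
have KD y z : K y -> K z -> K (y + z).
  by move=> Ky Kz; rewrite -[z]opprK; apply: KB => //; exact: KN.
have [z <-] := quotmap_surj x.
elim/freeg_ind_dom0: z => [|k [p q] D _ _ KDD]; first by rewrite raddf0.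
rewrite raddfD; apply: (KD) => //.
have -> : << k *g (p, q) >> = << (p, q) >> *~ k :> {freeg P * Q}.
  by rewrite freegU_mulz intz.
rewrite raddfMz; elim/int_rec: k => [|n IH|n IH]; rewrite ?mulr0z //.
  by rewrite intS mulrzDr; apply: KD => //; exact: Kt.
by rewrite intS opprD mulrzDr; apply: KD => //; apply: KN; exact: Kt.
Qed.

Definition balanced (W : zmodType) (f : P -> Q -> W) : Prop :=
  [/\ forall p p' q, f (p + p') q = f p q + f p' q,
      forall p q q', f p (q + q') = f p q + f p q' &
      forall p r q, f (p <* r) q = f p (r *> q)].

Section Lift.
Variables (W : zmodType) (f : P -> Q -> W).

Definition freeg_lift (z : {freeg (P * Q)}) : W :=
  fglift (fun pq => f pq.1 pq.2 : zmodule W) z.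
Let freeg_lift_zmod : zmod_morphism freeg_lift.
Proof. exact: (@lift_is_additive int _ (zmodule W)). Qed.
HB.instance Definition _ :=
  GRing.isZmodMorphism.Build _ W freeg_lift freeg_lift_zmod.
Lemma freeg_liftE p q : freeg_lift << (p, q) >> = f p q.
Proof. by rewrite /freeg_lift liftU scale1r. Qed.

Hypothesis fb : balanced f.

Let freeg_lift_rel z : @tensor_rel R P Q z -> freeg_lift z = 0.
Proof.
have [fDl fDr fB] := fb.
case=> [[]|] [x [y [z' ->]]]; rewrite !raddfB /= !freeg_liftE.
- by rewrite fDl addrAC addrK subrr.
- by rewrite fDr addrAC addrK subrr.
- by rewrite fB subrr.
Qed.

Definition tensor_lift : {additive tensor P Q -> W} := quotlift freeg_lift_rel.
Lemma tensor_liftE p q : tensor_lift (p \ox q) = f p q.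
Proof. by rewrite -(freeg_liftE p q); exact: quotliftE. Qed.

End Lift.

Lemma tensor_ext (W : zmodType) (f g : {additive tensor P Q -> W}) :
  (forall p q, f (p \ox q) = g (p \ox q)) -> f =1 g.
Proof.
move=> fg; apply: tensor_ind => [|x y fx fy|//]; first by rewrite !raddf0.
by rewrite !raddfB fx fy.
Qed.

Let tlact_balanced r : balanced (fun (p : P) (q : Q) => (r *> p) \ox q).
Proof.
split=> *; first by rewrite lactDr tensDl.
  by rewrite tensDr.
by rewrite lractA tens_balanced.
Qed.
Let tract_balanced r : balanced (fun (p : P) (q : Q) => p \ox (q <* r)).
Proof.
split=> *; first by rewrite tensDl.
  by rewrite ractDl tensDr.
by rewrite -lractA tens_balanced.
Qed.

Definition tlact r : tensor P Q -> tensor P Q := tensor_lift (tlact_balanced r).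
Definition tract (t : tensor P Q) r : tensor P Q := tensor_lift (tract_balanced r) t.

Let tlactE r p q : tlact r (p \ox q) = (r *> p) \ox q.
Proof. exact: tensor_liftE. Qed.
Let tractE r p q : tract (p \ox q) r = p \ox (q <* r).
Proof. exact: tensor_liftE. Qed.
Let tlactDr r m n : tlact r (m + n) = tlact r m + tlact r n.
Proof. exact: raddfD. Qed.
Let tractDl m n r : tract (m + n) r = tract m r + tract n r.
Proof. exact: raddfD. Qed.
Let tlactBr r m n : tlact r (m - n) = tlact r m - tlact r n.
Proof. exact: raddfB. Qed.
Let tractBl m n r : tract (m - n) r = tract m r - tract n r.
Proof. exact: raddfB. Qed.
Let tlact0 r : tlact r 0 = 0. Proof. exact: raddf0. Qed.
Let tract0 r : tract 0 r = 0. Proof. exact: raddf0. Qed.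

Let tlactDl r s m : tlact (r + s) m = tlact r m + tlact s m.
Proof.
elim/tensor_ind: m => [|x y IHx IHy|p q]; first by rewrite !tlact0 addr0.
  by rewrite !tlactBr IHx IHy opprD addrACA.
by rewrite !tlactE lactDl tensDl.
Qed.
Let tractDr m r s : tract m (r + s) = tract m r + tract m s.
Proof.
elim/tensor_ind: m => [|x y IHx IHy|p q]; first by rewrite !tract0 addr0.
  by rewrite !tractBl IHx IHy opprD addrACA.
by rewrite !tractE ractDr tensDr.
Qed.
Let tlactM r s m : tlact (r * s) m = tlact r (tlact s m).
Proof.
elim/tensor_ind: m => [|x y IHx IHy|p q]; first by rewrite !tlact0.
  by rewrite !tlactBr IHx IHy.
by rewrite !tlactE lactM.
Qed.
Let tractM m r s : tract m (r * s) = tract (tract m r) s.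
Proof.
elim/tensor_ind: m => [|x y IHx IHy|p q]; first by rewrite !tract0.
  by rewrite !tractBl IHx IHy.
by rewrite !tractE ractM.
Qed.
Let tlractA r m s : tlact r (tract m s) = tract (tlact r m) s.
Proof.
elim/tensor_ind: m => [|x y IHx IHy|p q].
- by rewrite tract0 !tlact0 tract0.
- by rewrite !(tlactBr, tractBl) IHx IHy.
- by rewrite !(tractE, tlactE).
Qed.
HB.instance Definition _ := Zmodule_isBimod.Build R (tensor P Q)
  tlactDl tlactDr tlactM tractDl tractDr tractM tlractA.

Lemma lact_tens r p q : r *> (p \ox q) = (r *> p) \ox q.
Proof. exact: tlactE. Qed.
Lemma ract_tens r p q : (p \ox q) <* r = p \ox (q <* r).
Proof. exact: tractE. Qed.

End TensorTheory.

Record rsystem (R : rngType) := RSystem {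
  sysP : bimodType R;
  sysQ : bimodType R;
  psi : {additive tensor sysP sysQ -> R};
  psiMl : forall r t, psi (r *> t) = r * psi t;
  psiMr : forall t r, psi (t <* r) = psi t * r
}.

Section System.
Variables (R : rngType) (X : rsystem R).
Local Notation P := (sysP X).
Local Notation Q := (sysQ X).

Definition thetaQ (q : Q) (p : P) : Q -> Q := fun x => q <* psi X (p \ox x).
Definition thetaP (p : P) (q : Q) : P -> P := fun y => psi X (y \ox q) *> p.

Definition thetasQ : set (Q -> Q) := [set f | exists q p, f = thetaQ q p].
Definition thetasP : set (P -> P) := [set f | exists p q, f = thetaP p q].

Definition calFPQ : set (Q -> Q) := zspan thetasQ.
Definition calFQP : set (P -> P) := zspan thetasP.

Definition Delta (r : R) : Q -> Q := fun q => r *> q.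

Definition condFS : Prop := forall (qs : seq Q) (ps : seq P),
  exists Theta Omega, [/\ calFPQ Theta, calFQP Omega,
    {in qs, forall q, Theta q = q} & {in ps, forall p, Omega p = p}].

(* The set calFPQ of endomorphisms of Q is closed under composition; as a     *)
(* type, it is a ring.                                                        *)
Record calF := CalF { calF_fun :> Q -> Q; calF_mem : zspan_pred thetasQ calF_fun }.
HB.instance Definition _ := [isSub for calF_fun].
HB.instance Definition _ := [Choice of calF by <:].
HB.instance Definition _ := [SubChoice_isSubZmodule of calF by <:].

Lemma calFP (f : calF) : calFPQ f.
Proof. exact/asboolP/calF_mem. Qed.

Lemma calF_inj (f g : calF) : f =1 g -> f = g.
Proof. by move=> fg; apply: val_inj; apply: funext. Qed.

Lemma thetaQB q p x y : thetaQ q p (x - y) = thetaQ q p x - thetaQ q p y.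
Proof.
rewrite /thetaQ -ractBr -raddfB; congr (_ <* psi X _).
by apply/eqP; rewrite eq_sym subr_eq -tensDr subrK.
Qed.

Lemma thetaQ_comp q p q' p' :
  thetaQ q p \o thetaQ q' p' = thetaQ (q <* psi X (p \ox q')) p'.
Proof. by apply: funext => x; rewrite /= /thetaQ -ract_tens psiMr ractM. Qed.

Lemma calFPQ_theta q p : calFPQ (thetaQ q p).
Proof. by apply: zspan_mem; exists q, p. Qed.

Lemma calFPQB f x y : calFPQ f -> f (x - y) = f x - f y.
Proof.
suff : calFPQ `<=` [set f | f (x - y) = f x - f y] by apply.
apply: zspan_sub => [|_ [q [p ->]]]; last exact: thetaQB.
split=> /= [|g h gB hB]; first by rewrite /= [RHS]subr0.
rewrite -[LHS]/(g (x - y) - h (x - y)) -[RHS]/((g x - h x) - (g y - h y)).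
by rewrite gB hB !opprD !opprK addrACA.
Qed.

Lemma calFPQD f x y : calFPQ f -> f (x + y) = f x + f y.
Proof.
move=> Ff; have fN z : f (- z) = - f z.
  by rewrite -sub0r calFPQB // -(subrr z) calFPQB // subrr sub0r.
by rewrite -[y in LHS]opprK calFPQB // fN opprK.
Qed.

Lemma calFPQ_comp f g : calFPQ f -> calFPQ g -> calFPQ (f \o g).
Proof.
move=> Ff Fg; suff : calFPQ `<=` [set f : Q -> Q | calFPQ (f \o g)] by apply.
apply: zspan_sub => [|_ [q [p ->]]]; first by split=> [|h k]; [exact: zspan0|exact: zspanB].
suff : calFPQ `<=` [set g : Q -> Q | calFPQ (thetaQ q p \o g)] by apply.
apply: zspan_sub => [|_ [q' [p' ->]]]; last first.
  by rewrite /= thetaQ_comp; exact: calFPQ_theta.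
split=> /= [|h k Fh Fk].
  suff -> : thetaQ q p \o (0 : Q -> Q) = (0 : Q -> Q) by exact: zspan0.
  apply/funeqP => x; rewrite -[LHS]/(thetaQ q p 0) -[RHS]/(0 : Q).
  by rewrite -(subrr (0 : Q)) thetaQB !subrr.
suff -> : thetaQ q p \o (h - k) =
    (thetaQ q p \o h) - (thetaQ q p \o k) by exact: zspanB.
by apply/funeqP => x; exact: thetaQB.
Qed.

Lemma calF_mul_subproof (f g : calF) : zspan_pred thetasQ (f \o g).
Proof. by apply/asboolP; apply: calFPQ_comp; exact: calFP. Qed.
Definition calF_mul (f g : calF) : calF := CalF (calF_mul_subproof f g).

Let calF_mulA : associative calF_mul.
Proof. by move=> f g h; apply: val_inj. Qed.
Let calF_mulDl : left_distributive calF_mul +%R.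
Proof. by move=> f g h; apply: val_inj. Qed.
Let calF_mulDr : right_distributive calF_mul +%R.
Proof.
move=> f g h; apply: val_inj; apply: funext => x.
exact: (calFPQD (g x) (h x) (calFP f)).
Qed.
HB.instance Definition _ :=
  Zmodule_isRng.Build calF calF_mulA calF_mulDl calF_mulDr.

Definition theta (q : Q) (p : P) : calF := CalF (asboolT (calFPQ_theta q p)).

End System.

Record covrep (R : rngType) (X : rsystem R) := CovRep {
  cod :> rngType;
  repP : {additive sysP X -> cod};
  repQ : {additive sysQ X -> cod};
  repR : {rngmorphism R -> cod};
  repP_ract : forall p r, repP (p <* r) = repP p * repR r;
  repP_lact : forall r p, repP (r *> p) = repR r * repP p;
  repQ_ract : forall q r, repQ (q <* r) = repQ q * repR r;
  repQ_lact : forall r q, repQ (r *> q) = repR r * repQ q;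
  rep_psi : forall p q, repR (psi X (p \ox q)) = repP p * repQ q
}.

Definition intertwines (R : rngType) (X : rsystem R) (Y Z : covrep X)
    (eta : Y -> Z) : Prop :=
  [/\ eta \o repR Y =1 repR Z, eta \o repQ Y =1 repQ Z & eta \o repP Y =1 repP Z].

Definition is_subring (B : rngType) (C : set B) : Prop :=
  is_subgroup C /\ forall x y, C x -> C y -> C (x * y).

Definition surjective_rep (R : rngType) (X : rsystem R) (Z : covrep X) : Prop :=
  smallest (@is_subring Z) (range (repR Z) `|` range (repQ Z) `|` range (repP Z))
  = setT.

(* B is the internal direct sum of the subgroups G n, and the multiplication  *)
(* adds degrees.                                                              *)
Definition is_grading (B : rngType) (G : int -> set B) : Prop :=
  [/\ forall n, is_subgroup (G n),
      forall b, exists! c : int -> B,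
        [/\ forall n, G n (c n), finite_set [set n | c n != 0] &
            b = \sum_(n \in setT) c n] &
      forall m n x y, G m x -> G n y -> G (m + n) (x * y)].

Definition graded_rep (R : rngType) (X : rsystem R) (Z : covrep X) : Prop :=
  exists G : int -> set Z, [/\ is_grading G, range (repR Z) `<=` G 0,
    range (repQ Z) `<=` G 1 & range (repP Z) `<=` G (- 1)].

Section PushForward.
Variables (R : rngType) (X : rsystem R) (Y : covrep X) (B : rngType).
Variable f : {rngmorphism Y -> B}.

Let push_repP_ract p r : (f \o repP Y) (p <* r) = (f \o repP Y) p * (f \o repR Y) r.
Proof. by rewrite /= repP_ract gmulfM. Qed.
Let push_repP_lact r p : (f \o repP Y) (r *> p) = (f \o repR Y) r * (f \o repP Y) p.
Proof. by rewrite /= repP_lact gmulfM. Qed.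
Let push_repQ_ract q r : (f \o repQ Y) (q <* r) = (f \o repQ Y) q * (f \o repR Y) r.
Proof. by rewrite /= repQ_ract gmulfM. Qed.
Let push_repQ_lact r q : (f \o repQ Y) (r *> q) = (f \o repR Y) r * (f \o repQ Y) q.
Proof. by rewrite /= repQ_lact gmulfM. Qed.
Let push_rep_psi p q :
  (f \o repR Y) (psi X (p \ox q)) = (f \o repP Y) p * (f \o repQ Y) q.
Proof. by rewrite /= rep_psi gmulfM. Qed.

Definition covrep_push : covrep X := @CovRep R X B
  (f \o repP Y) (f \o repQ Y) (f \o repR Y) push_repP_ract push_repP_lact
  push_repQ_ract push_repQ_lact push_rep_psi.

End PushForward.

Section PiTS.
Variables (R : rngType) (X : rsystem R) (fs : condFS X) (Z : covrep X).
Local Notation P := (sysP X).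
Local Notation Q := (sysQ X).

Let thsum (s : seq (Q * P)) : Q -> Q := \sum_(i <- s) thetaQ i.1 i.2.
Let pisum (s : seq (Q * P)) : Z := \sum_(i <- s) repQ Z i.1 * repP Z i.2.
Let negs (s : seq (Q * P)) : seq (Q * P) := [seq (- i.1, i.2) | i <- s].

Let thsumE s x : thsum s x = \sum_(i <- s) thetaQ i.1 i.2 x.
Proof. by rewrite /thsum fct_sumE. Qed.
Let thsum_cat s t : thsum (s ++ t) = thsum s + thsum t.
Proof. by rewrite /thsum big_cat. Qed.
Let pisum_cat s t : pisum (s ++ t) = pisum s + pisum t.
Proof. by rewrite /pisum big_cat. Qed.
Let thsum_neg s : thsum (negs s) = - thsum s.
Proof.
rewrite /thsum big_map -sumrN; apply: eq_bigr => i _ /=.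
by apply/funeqP => x; rewrite /thetaQ ractNl.
Qed.
Let pisum_neg s : pisum (negs s) = - pisum s.
Proof.
by rewrite /pisum big_map -sumrN; apply: eq_bigr => i _ /=; rewrite raddfN rngNM.
Qed.

Let thsum_ex f : calFPQ f -> exists s, f = thsum s.
Proof.
suff : @calFPQ R X `<=` [set f | exists s, f = thsum s] by apply.
apply: zspan_sub => [|_ [q [p ->]]]; last first.
  by exists [:: (q, p)]; rewrite /thsum big_seq1.
split=> [|_ _ [s ->] [t ->]]; first by exists [::]; rewrite /thsum big_nil.
by exists (s ++ negs t); rewrite thsum_cat thsum_neg.
Qed.

Let thetaP_ex f : calFQP f ->
  exists s : seq (P * Q), forall y, f y = \sum_(k <- s) psi X (y \ox k.2) *> k.1.
Proof.
suff : @calFQP R X `<=` [set f | exists s : seq (P * Q),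
  forall y, f y = \sum_(k <- s) psi X (y \ox k.2) *> k.1] by apply.
apply: zspan_sub => [|_ [p [q ->]]]; last first.
  by exists [:: (p, q)] => y; rewrite big_seq1.
split=> [|g h [s gE] [t hE]]; first by exists [::] => y; rewrite big_nil.
exists (s ++ [seq (- i.1, i.2) | i <- t]) => y.
rewrite big_cat big_map /= -gE -[LHS]/(g y - h y) hE -sumrN.
by congr (_ + _); apply: eq_bigr => i _; rewrite lactNr.
Qed.

Let pisum_eq0 s : thsum s = 0 -> pisum s = 0.
Proof.
move=> s0; have [_ [W [_ FW _ Wp]]] := fs [::] [seq i.2 | i <- s].
have [t WE] := thetaP_ex FW.
transitivity (\sum_(i <- s) \sum_(k <- t)
    repQ Z (thetaQ i.1 i.2 k.2) * repP Z k.1).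
  rewrite /pisum; apply: eq_big_seq => i si.
  rewrite -[in LHS](Wp i.2) ?WE; last exact: map_f.
  rewrite raddf_sum rng_sumr; apply: eq_bigr => k _.
  by rewrite repP_lact /thetaQ repQ_ract mulgA.
rewrite exchange_big /= big1 // => k _.
by rewrite -rng_suml -raddf_sum -thsumE s0 raddf0 rng0M.
Qed.

Let thsum_inj s t : thsum s = thsum t -> pisum s = pisum t.
Proof.
move=> st; apply/eqP; rewrite -subr_eq0 -pisum_neg -pisum_cat.
by apply/eqP/pisum_eq0; rewrite thsum_cat thsum_neg st subrr.
Qed.

Let thetaQ_sum q p (t : seq (Q * P)) (F : Q * P -> Q) :
  thetaQ q p (\sum_(j <- t) F j) = \sum_(j <- t) thetaQ q p (F j).
Proof.
apply: (big_morph (thetaQ q p)) => [x y|]; first by apply: calFPQD; exact: calFPQ_theta.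
by rewrite -(subrr (0 : Q)) thetaQB !subrr.
Qed.

Let dec (f : calF X) : seq (Q * P) := sval (cid (thsum_ex (calFP f))).
Let decE (f : calF X) : f = thsum (dec f) :> (Q -> Q).
Proof. exact: (svalP (cid (thsum_ex (calFP f)))). Qed.
Let pi0 (f : calF X) : Z := pisum (dec f).
Let pi0E (f : calF X) s : f = thsum s :> (Q -> Q) -> pi0 f = pisum s.
Proof. by move=> fE; apply: thsum_inj; rewrite -decE. Qed.

Let pi0_zmod : zmod_morphism pi0.
Proof.
move=> f g; rewrite -pisum_neg -pisum_cat; apply: pi0E.
by rewrite thsum_cat thsum_neg -!decE.
Qed.
Let pi0_mul : {morph pi0 : f g / f * g}.
Proof.
move=> f g; rewrite /(pi0 f) /(pi0 g) /pisum rng_suml.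
transitivity (pisum [seq (i.1 <* psi X (i.2 \ox j.1), j.2) | i <- dec f, j <- dec g]).
  apply: pi0E; rewrite /thsum big_allpairs_dep /=; apply/funeqP => x.
  rewrite -[LHS]/((f : Q -> Q) ((g : Q -> Q) x)) fct_sumE [in LHS]decE thsumE.
  apply: eq_bigr => i _; rewrite fct_sumE decE thsumE.
  rewrite thetaQ_sum; apply: eq_bigr => j _ /=.
  exact: (congr1 (@^~ x) (thetaQ_comp _ _ _ _)).
rewrite /pisum big_allpairs_dep; apply: eq_bigr => i _.
rewrite rng_sumr; apply: eq_bigr => j _ /=.
by rewrite repQ_ract rep_psi !mulgA.
Qed.

Let pi0_theta q p : pi0 (theta q p) = repQ Z q * repP Z p.
Proof. by rewrite (@pi0E _ [:: (q, p)]) /pisum ?/thsum big_seq1. Qed.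

HB.instance Definition _ := GRing.isZmodMorphism.Build (calF X) Z pi0 pi0_zmod.
HB.instance Definition _ := monoid.isMultiplicative.Build (calF X) Z pi0 pi0_mul.

Lemma piTS_exists :
  exists pi : {rngmorphism calF X -> Z}, forall q p,
    pi (theta q p) = repQ Z q * repP Z p.
Proof. by exists pi0; exact: pi0_theta. Qed.

Definition piTS : {rngmorphism calF X -> Z} := sval (cid piTS_exists).

Lemma piTS_theta q p : piTS (theta q p) = repQ Z q * repP Z p.
Proof. exact: (svalP (cid piTS_exists)). Qed.

Lemma piTS_unique (pi : {rngmorphism calF X -> Z}) :
  (forall q p, pi (theta q p) = repQ Z q * repP Z p) -> pi =1 piTS.
Proof.
move=> piE f; have -> : f = \sum_(i <- dec f) theta i.1 i.2.
  apply: calF_inj => x; rewrite {1}decE thsumE.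
  by elim/big_rec2: _ => [|i y g _ ->].
by rewrite !raddf_sum; apply: eq_bigr => i _ /=; rewrite piE piTS_theta.
Qed.

End PiTS.

Section Toeplitz.
Variables (R : rngType) (X : rsystem R).
Local Notation P := (sysP X).
Local Notation Q := (sysQ X).

(* The Toeplitz ring is constructed by generators and relations: ring terms   *)
(* over R + P + Q modulo the ring axioms and those of a covariant             *)
(* representation.                                                            *)
Inductive toep_term :=
  | TR of R | TP of P | TQ of Q
  | TZero | TAdd of toep_term & toep_term | TOpp of toep_term
  | TMul of toep_term & toep_term.

Inductive toep_rel : toep_term -> toep_term -> Prop :=
  | TRrefl x : toep_rel x x
  | TRsym x y : toep_rel x y -> toep_rel y x
  | TRtrans y x z : toep_rel x y -> toep_rel y z -> toep_rel x z
  | TRadd x x' y y' : toep_rel x x' -> toep_rel y y' -> toep_rel (TAdd x y) (TAdd x' y')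
  | TRopp x x' : toep_rel x x' -> toep_rel (TOpp x) (TOpp x')
  | TRmul x x' y y' : toep_rel x x' -> toep_rel y y' -> toep_rel (TMul x y) (TMul x' y')
  | TRaddA x y z : toep_rel (TAdd x (TAdd y z)) (TAdd (TAdd x y) z)
  | TRaddC x y : toep_rel (TAdd x y) (TAdd y x)
  | TRadd0 x : toep_rel (TAdd TZero x) x
  | TRaddN x : toep_rel (TAdd (TOpp x) x) TZero
  | TRmulA x y z : toep_rel (TMul x (TMul y z)) (TMul (TMul x y) z)
  | TRmulDl x y z : toep_rel (TMul (TAdd x y) z) (TAdd (TMul x z) (TMul y z))
  | TRmulDr x y z : toep_rel (TMul x (TAdd y z)) (TAdd (TMul x y) (TMul x z))
  | TR_R_add r s : toep_rel (TR (r + s)) (TAdd (TR r) (TR s))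
  | TR_R_mul r s : toep_rel (TR (r * s)) (TMul (TR r) (TR s))
  | TR_P_add p p' : toep_rel (TP (p + p')) (TAdd (TP p) (TP p'))
  | TR_Q_add q q' : toep_rel (TQ (q + q')) (TAdd (TQ q) (TQ q'))
  | TR_P_ract p r : toep_rel (TP (p <* r)) (TMul (TP p) (TR r))
  | TR_P_lact r p : toep_rel (TP (r *> p)) (TMul (TR r) (TP p))
  | TR_Q_ract q r : toep_rel (TQ (q <* r)) (TMul (TQ q) (TR r))
  | TR_Q_lact r q : toep_rel (TQ (r *> q)) (TMul (TR r) (TQ q))
  | TR_psi p q : toep_rel (TR (psi X (p \ox q))) (TMul (TP p) (TQ q)).

HB.instance Definition _ := gen_eqMixin toep_term.
HB.instance Definition _ := gen_choiceMixin toep_term.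

Definition toep_relb : rel toep_term := fun x y => `[< toep_rel x y >].

Let toep_refl : reflexive toep_relb.
Proof. by move=> x; apply/asboolP; exact: TRrefl. Qed.
Let toep_sym : symmetric toep_relb.
Proof.
by move=> x y; apply/idP/idP => /asboolP xy; apply/asboolP; exact: TRsym.
Qed.
Let toep_trans : transitive toep_relb.
Proof.
by move=> y x z /asboolP xy /asboolP yz; apply/asboolP; exact: (TRtrans xy).
Qed.
Canonical toep_equiv := EquivRel toep_relb toep_refl toep_sym toep_trans.

Definition toep_ring : Type := {eq_quot toep_equiv}%qT.
HB.instance Definition _ := Choice.on toep_ring.

Definition toep_class (x : toep_term) : toep_ring := \pi_({eq_quot toep_equiv})%qT x.
Definition toep_repr (a : toep_ring) : toep_term := repr (a : {eq_quot toep_equiv}%qT).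

Lemma toep_reprK : cancel toep_repr toep_class. Proof. exact: reprK. Qed.
Lemma toep_classP x y : toep_class x = toep_class y <-> toep_rel x y.
Proof. by split=> [/eqmodP/asboolP|xy] //; apply/eqmodP/asboolP. Qed.
Lemma toep_surj a : exists x, toep_class x = a.
Proof. by exists (toep_repr a); rewrite toep_reprK. Qed.
Lemma toep_reprP x : toep_rel (toep_repr (toep_class x)) x.
Proof. by apply/toep_classP; rewrite toep_reprK. Qed.

Definition toep_add (a b : toep_ring) := toep_class (TAdd (toep_repr a) (toep_repr b)).
Definition toep_opp (a : toep_ring) := toep_class (TOpp (toep_repr a)).
Definition toep_mul (a b : toep_ring) := toep_class (TMul (toep_repr a) (toep_repr b)).

Let addE x y : toep_add (toep_class x) (toep_class y) = toep_class (TAdd x y).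
Proof. by apply/toep_classP/TRadd; exact: toep_reprP. Qed.
Let oppE x : toep_opp (toep_class x) = toep_class (TOpp x).
Proof. by apply/toep_classP/TRopp; exact: toep_reprP. Qed.
Let mulE x y : toep_mul (toep_class x) (toep_class y) = toep_class (TMul x y).
Proof. by apply/toep_classP/TRmul; exact: toep_reprP. Qed.

Let toep_addA : associative toep_add.
Proof.
move=> a b c; have [x <-] := toep_surj a; have [y <-] := toep_surj b.
by have [z <-] := toep_surj c; rewrite !addE; apply/toep_classP; exact: TRaddA.
Qed.
Let toep_addC : commutative toep_add.
Proof.
move=> a b; have [x <-] := toep_surj a; have [y <-] := toep_surj b.
by rewrite !addE; apply/toep_classP; exact: TRaddC.
Qed.
Let toep_add0 : left_id (toep_class TZero) toep_add.
Proof.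
by move=> a; have [x <-] := toep_surj a; rewrite addE; apply/toep_classP; exact: TRadd0.
Qed.
Let toep_addN : left_inverse (toep_class TZero) toep_opp toep_add.
Proof.
move=> a; have [x <-] := toep_surj a; rewrite oppE addE.
by apply/toep_classP; exact: TRaddN.
Qed.
HB.instance Definition _ :=
  GRing.isZmodule.Build toep_ring toep_addA toep_addC toep_add0 toep_addN.

Let toep_mulA : associative toep_mul.
Proof.
move=> a b c; have [x <-] := toep_surj a; have [y <-] := toep_surj b.
by have [z <-] := toep_surj c; rewrite !mulE; apply/toep_classP; exact: TRmulA.
Qed.
Let toep_mulDl : left_distributive toep_mul +%R.
Proof.
move=> a b c; have [x <-] := toep_surj a; have [y <-] := toep_surj b.
have [z <-] := toep_surj c; rewrite /GRing.add /= !(mulE, addE).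
by apply/toep_classP; exact: TRmulDl.
Qed.
Let toep_mulDr : right_distributive toep_mul +%R.
Proof.
move=> a b c; have [x <-] := toep_surj a; have [y <-] := toep_surj b.
have [z <-] := toep_surj c; rewrite /GRing.add /= !(mulE, addE).
by apply/toep_classP; exact: TRmulDr.
Qed.
HB.instance Definition _ :=
  Zmodule_isRng.Build toep_ring toep_mulA toep_mulDl toep_mulDr.

Lemma toep_classD x y : toep_class (TAdd x y) = toep_class x + toep_class y.
Proof. by rewrite -addE. Qed.
Lemma toep_classN x : toep_class (TOpp x) = - toep_class x.
Proof. by rewrite -oppE. Qed.
Lemma toep_class0 : toep_class TZero = 0. Proof. by []. Qed.
Lemma toep_classM x y : toep_class (TMul x y) = toep_class x * toep_class y.
Proof. by rewrite -mulE. Qed.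

Definition iotaR (r : R) : toep_ring := toep_class (TR r).
Definition iotaP (p : P) : toep_ring := toep_class (TP p).
Definition iotaQ (q : Q) : toep_ring := toep_class (TQ q).

Let additiveP (V W : zmodType) (f : V -> W) :
  {morph f : x y / x + y} -> zmod_morphism f.
Proof.
move=> fD x y; apply: (@addIr _ (f y)); rewrite subrK -fD subrK //.
Qed.

Let iotaR_zmod : zmod_morphism iotaR.
Proof.
apply: additiveP => x y; rewrite -[RHS]toep_classD; apply/toep_classP.
exact: TR_R_add.
Qed.
Let iotaP_zmod : zmod_morphism iotaP.
Proof.
apply: additiveP => x y; rewrite -[RHS]toep_classD; apply/toep_classP.
exact: TR_P_add.
Qed.
Let iotaQ_zmod : zmod_morphism iotaQ.
Proof.
apply: additiveP => x y; rewrite -[RHS]toep_classD; apply/toep_classP.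
exact: TR_Q_add.
Qed.
Let iotaR_mul : {morph iotaR : x y / x * y}.
Proof.
move=> x y; rewrite -[RHS]toep_classM; apply/toep_classP.
exact: TR_R_mul.
Qed.
HB.instance Definition _ := GRing.isZmodMorphism.Build R toep_ring iotaR iotaR_zmod.
HB.instance Definition _ := GRing.isZmodMorphism.Build P toep_ring iotaP iotaP_zmod.
HB.instance Definition _ := GRing.isZmodMorphism.Build Q toep_ring iotaQ iotaQ_zmod.
HB.instance Definition _ := monoid.isMultiplicative.Build R toep_ring iotaR iotaR_mul.

Let iotaP_ract p r : iotaP (p <* r) = iotaP p * iotaR r.
Proof. by rewrite -[RHS]toep_classM; apply/toep_classP; exact: TR_P_ract. Qed.
Let iotaP_lact r p : iotaP (r *> p) = iotaR r * iotaP p.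
Proof. by rewrite -[RHS]toep_classM; apply/toep_classP; exact: TR_P_lact. Qed.
Let iotaQ_ract q r : iotaQ (q <* r) = iotaQ q * iotaR r.
Proof. by rewrite -[RHS]toep_classM; apply/toep_classP; exact: TR_Q_ract. Qed.
Let iotaQ_lact r q : iotaQ (r *> q) = iotaR r * iotaQ q.
Proof. by rewrite -[RHS]toep_classM; apply/toep_classP; exact: TR_Q_lact. Qed.
Let iota_psi p q : iotaR (psi X (p \ox q)) = iotaP p * iotaQ q.
Proof. by rewrite -[RHS]toep_classM; apply/toep_classP; exact: TR_psi. Qed.

Definition toeplitz : covrep X := @CovRep R X toep_ring iotaP iotaQ iotaR
  iotaP_ract iotaP_lact iotaQ_ract iotaQ_lact iota_psi.

Lemma toeplitz_surjective : surjective_rep toeplitz.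
Proof.
rewrite /surjective_rep; set A := _ `|` _; apply/seteqP; split=> // a _.
have [x <-] := toep_surj a => C [[[C0 CB] CM] AC].
have CN b : C b -> C (- b) by move=> Cb; rewrite -sub0r; exact: CB.
elim: x => [r|p|q||x Cx y Cy|x Cx|x Cx y Cy].
- by apply: AC; left; left; exists r.
- by apply: AC; right; exists p.
- by apply: AC; left; right; exists q.
- exact: C0.
- by rewrite toep_classD -[toep_class y]opprK; apply: CB => //; exact: CN.
- by rewrite toep_classN; exact: CN.
- by rewrite toep_classM; exact: CM.
Qed.

Section Universal.
Variable Z : covrep X.

Fixpoint toep_eval (x : toep_term) : Z := match x with
  | TR r => repR Z r | TP p => repP Z p | TQ q => repQ Z q
  | TZero => 0 | TAdd x y => toep_eval x + toep_eval y
  | TOpp x => - toep_eval x | TMul x y => toep_eval x * toep_eval y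
  end.

Let toep_eval_rel x y : toep_rel x y -> toep_eval x = toep_eval y.
Proof.
by elim=> //= *; rewrite ?(raddfD, gmulfM, repP_ract, repP_lact, repQ_ract,
  repQ_lact, rep_psi, rngMDl, rngMDr, mulgA, addrA, add0r, addNr) //;
  [congruence..|exact: addrC].
Qed.

Definition toep_lift (a : toep_ring) : Z := toep_eval (toep_repr a).
Let toep_liftE x : toep_lift (toep_class x) = toep_eval x.
Proof. by apply: toep_eval_rel; exact: toep_reprP. Qed.
Let toep_lift_zmod : zmod_morphism toep_lift.
Proof.
apply: additiveP => a b; have [x <-] := toep_surj a; have [y <-] := toep_surj b.
by rewrite -toep_classD !toep_liftE.
Qed.
Let toep_lift_mul : {morph toep_lift : x y / x * y}.
Proof.
move=> a b; have [x <-] := toep_surj a; have [y <-] := toep_surj b.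
by rewrite -toep_classM !toep_liftE.
Qed.
HB.instance Definition _ :=
  GRing.isZmodMorphism.Build toep_ring Z toep_lift toep_lift_zmod.
HB.instance Definition _ :=
  monoid.isMultiplicative.Build toep_ring Z toep_lift toep_lift_mul.

Lemma toeplitz_universal :
  exists! eta : {rngmorphism toeplitz -> Z}, intertwines eta.
Proof.
exists toep_lift; split=> [|eta [eR eQ eP]]; first by split=> x /=; exact: toep_liftE.
apply: rngmorphismP => a; have [x <-] := toep_surj a; rewrite [LHS]toep_liftE.
elim: x => [r|p|q||x Hx y Hy|x Hx|x Hx y Hy] /=; rewrite ?Hx ?Hy.
- by rewrite -[LHS]eR.
- by rewrite -[LHS]eP.
- by rewrite -[LHS]eQ.
- by rewrite toep_class0 raddf0.
- by rewrite toep_classD raddfD.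
- by rewrite toep_classN raddfN.
- by rewrite toep_classM gmulfM.
Qed.

End Universal.

End Toeplitz.

Section RelativeCuntzPimsner.
Variables (R : rngType) (X : rsystem R).

Definition psi_compatible (J : rideal R) : Prop := J `<=` @Delta R X @^-1` @calFPQ R X.

Definition faithful (J : rideal R) : Prop :=
  J `&` [set r | @Delta R X r = 0] = [set 0].

Variables (fs : condFS X) (J : rideal R).

(* calT J is generated by the differences of iota_R(x) and pi(Delta(x)): for  *)
(* x in a psi-compatible J, the element f of calF X below is Delta(x).        *)
Definition calT : rideal (toeplitz X) := ideal_gen
  [set y | exists x (f : calF X), [/\ ideal_set J x, f = Delta x :> (_ -> _) &
     y = repR (toeplitz X) x - piTS fs (toeplitz X) f]].

Definition calO : covrep X := covrep_push (rproj calT).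

End RelativeCuntzPimsner.

Definition psi_invariant (R : rngType) (X : rsystem R) (I : rideal R) : Prop :=
  forall p q x, ideal_set I x -> ideal_set I (psi X (p \ox (x *> q))).

Section QuotientSystem.
Variables (R : rngType) (X : rsystem R) (fs : condFS X) (I : rideal R).
Hypothesis inv : psi_invariant X I.
Local Notation P := (sysP X).
Local Notation Q := (sysQ X).

Definition prodQI : set Q := [set m | exists q x, ideal_set I x /\ m = q <* x].
Definition prodIP : set P := [set m | exists x p, ideal_set I x /\ m = x *> p].

Lemma prodQI_compat : bimod_compat I prodQI.
Proof.
split=> [r _ [q [x [Ix ->]]]|r _ [q [x [Ix ->]]]|x m Ix|x m Ix].
- by apply: zspan_mem; exists (r *> q), x; rewrite lractA.
- by apply: zspan_mem; exists q, (x * r); rewrite ractM; split=> //; exact: idealMr.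
- have [T [_ [FT _ Tm _]]] := fs [:: x *> m] [::].
  rewrite -(Tm (x *> m) (mem_head _ _)).
  suff : @calFPQ R X `<=` [set f | zspan prodQI (f (x *> m))] by apply.
  apply: zspan_sub => [|_ [q [p ->]]].
    by split=> [|f g Ff Fg]; [exact: zspan0|exact: zspanB].
  by apply: zspan_mem; exists q, (psi X (p \ox (x *> m))); split=> //; exact: inv.
- by apply: zspan_mem; exists m, x.
Qed.

Lemma prodIP_compat : bimod_compat I prodIP.
Proof.
split=> [r _ [x [p [Ix ->]]]|r _ [x [p [Ix ->]]]|x m Ix|x m Ix].
- by apply: zspan_mem; exists (r * x), p; rewrite lactM; split=> //; exact: idealMl.
- by apply: zspan_mem; exists x, (p <* r); rewrite lractA.
- by apply: zspan_mem; exists x, m.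
- have [_ [T [_ FT _ Tm]]] := fs [::] [:: m <* x].
  rewrite -(Tm (m <* x) (mem_head _ _)).
  suff : @calFQP R X `<=` [set f | zspan prodIP (f (m <* x))] by apply.
  apply: zspan_sub => [|_ [p [q ->]]].
    by split=> [|f g Ff Fg]; [exact: zspan0|exact: zspanB].
  apply: zspan_mem; exists (psi X ((m <* x) \ox q)), p; split=> //.
  by rewrite tens_balanced; exact: inv.
Qed.

Definition quotQ : bimodType (rquot I) := bquot prodQI_compat.
Definition quotP : bimodType (rquot I) := bquot prodIP_compat.

Definition projQ : {additive Q -> quotQ} := bproj prodQI_compat.
Definition projP : {additive P -> quotP} := bproj prodIP_compat.

Lemma projQ_surj a : exists q, projQ q = a. Proof. exact: bproj_surj. Qed.
Lemma projP_surj a : exists p, projP p = a. Proof. exact: bproj_surj. Qed.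
Lemma projQl r q : projQ (r *> q) = rproj I r *> projQ q.
Proof. by apply: esym; exact: bprojl. Qed.
Lemma projQr r q : projQ (q <* r) = projQ q <* rproj I r.
Proof. by apply: esym; exact: bprojr. Qed.
Lemma projPl r p : projP (r *> p) = rproj I r *> projP p.
Proof. by apply: esym; exact: bprojl. Qed.
Lemma projPr r p : projP (p <* r) = projP p <* rproj I r.
Proof. by apply: esym; exact: bprojr. Qed.

Let tensBl (p p' : P) (q : Q) : (p - p') \ox q = p \ox q - p' \ox q.
Proof. by apply/eqP; rewrite eq_sym subr_eq -tensDl subrK. Qed.
Let tensBr (p : P) (q q' : Q) : p \ox (q - q') = p \ox q - p \ox q'.
Proof. by apply/eqP; rewrite eq_sym subr_eq -tensDr subrK. Qed.

Let psi_spanQ p q : zspan prodQI q -> ideal_set I (psi X (p \ox q)).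
Proof.
suff : zspan prodQI `<=` [set q | ideal_set I (psi X (p \ox q))] by apply.
apply: zspan_sub => [|_ [m [x [Ix ->]]]]; last first.
  by rewrite /= -ract_tens psiMr; exact: idealMl.
split=> /= [|y z Iy Iz]; last by rewrite tensBr raddfB; exact: idealB.
by rewrite -(subrr (0 : Q)) tensBr subrr raddf0; exact: ideal0.
Qed.
Let psi_spanP p q : zspan prodIP p -> ideal_set I (psi X (p \ox q)).
Proof.
suff : zspan prodIP `<=` [set p | ideal_set I (psi X (p \ox q))] by apply.
apply: zspan_sub => [|_ [x [m [Ix ->]]]]; last first.
  by rewrite /= -lact_tens psiMl; exact: idealMr.
split=> /= [|y z Iy Iz]; last by rewrite tensBl raddfB; exact: idealB.
by rewrite -(subrr (0 : P)) tensBl subrr raddf0; exact: ideal0.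
Qed.

Definition psiI0 (a : quotP) (b : quotQ) : rquot I :=
  rproj I (psi X (quotrepr (a : quotz prodIP) \ox quotrepr (b : quotz prodQI))).

Let psiI0E p q : psiI0 (projP p) (projQ q) = rproj I (psi X (p \ox q)).
Proof.
apply/rprojP; set p' := quotrepr _; set q' := quotrepr _.
have -> : psi X (p' \ox q') - psi X (p \ox q) =
    psi X (p' \ox (q' - q)) - (0 - psi X ((p' - p) \ox q)).
  by rewrite sub0r opprK tensBr tensBl !raddfB subrKA.
apply: idealB; first by apply: psi_spanQ; exact: quotreprP.
apply: idealB; first exact: ideal0.
by apply: psi_spanP; exact: quotreprP.
Qed.

Lemma psiI0_balanced : balanced psiI0.
Proof.
split=> [a a' b|a b b'|a r b].
- have [p <-] := projP_surj a; have [p' <-] := projP_surj a'.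
  by have [q <-] := projQ_surj b; rewrite -raddfD !psiI0E tensDl !raddfD.
- have [p <-] := projP_surj a; have [q' <-] := projQ_surj b'.
  by have [q <-] := projQ_surj b; rewrite -raddfD !psiI0E tensDr !raddfD.
- have [p <-] := projP_surj a; have [q <-] := projQ_surj b.
  by have [s <-] := rproj_surj r; rewrite -projPr -projQl !psiI0E tens_balanced.
Qed.

Definition psiI : {additive tensor quotP quotQ -> rquot I} := tensor_lift psiI0_balanced.

Lemma psiIE p q : psiI (projP p \ox projQ q) = rproj I (psi X (p \ox q)).
Proof. by rewrite -psiI0E; exact: tensor_liftE. Qed.

Let psiI_Ml r t : psiI (r *> t) = r * psiI t.
Proof.
elim/tensor_ind: t => [|x y IHx IHy|a b].
- by rewrite lact0r raddf0 rngM0.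
- by rewrite lactBr !raddfB IHx IHy rngMBr.
have [p <-] := projP_surj a; have [q <-] := projQ_surj b.
have [s <-] := rproj_surj r.
by rewrite lact_tens -projPl !psiIE -gmulfM -psiMl lact_tens.
Qed.
Let psiI_Mr t r : psiI (t <* r) = psiI t * r.
Proof.
elim/tensor_ind: t => [|x y IHx IHy|a b].
- by rewrite ract0l raddf0 rng0M.
- by rewrite ractBl !raddfB IHx IHy rngMBl.
have [p <-] := projP_surj a; have [q <-] := projQ_surj b.
have [s <-] := rproj_surj r.
by rewrite ract_tens -projQr !psiIE -gmulfM -psiMr ract_tens.
Qed.

Definition quot_system : rsystem (rquot I) :=
  @RSystem (rquot I) quotP quotQ psiI psiI_Ml psiI_Mr.

Lemma quot_condFS : condFS quot_system.
Proof.
move=> qs ps; pose rQ (b : quotQ) : Q := quotrepr (b : quotz prodQI).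
pose rP (a : quotP) : P := quotrepr (a : quotz prodIP).
have rQK b : projQ (rQ b) = b by exact: quotreprK.
have rPK a : projP (rP a) = a by exact: quotreprK.
have [T [W [FT FW Tq Wp]]] := fs (map rQ qs) (map rP ps).
have [T' [FT' TT']] : exists T', @calFPQ _ quot_system T' /\
    forall x, T' (projQ x) = projQ (T x).
  suff : @calFPQ R X `<=` [set T | exists T', @calFPQ _ quot_system T' /\
    forall x, T' (projQ x) = projQ (T x)] by apply.
  apply: zspan_sub => [|_ [q [p ->]]]; last first.
    exists (@thetaQ _ quot_system (projQ q) (projP p)); split.
      exact: calFPQ_theta.
    by move=> x; rewrite projQr -psiIE.
  split=> [|f g [f' [Ff fE]] [g' [Fg gE]]].
    by exists 0; split; [exact: zspan0|move=> x; rewrite [in RHS]raddf0].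
  exists (f' - g'); split; first exact: zspanB.
  by move=> x; rewrite -[LHS]/(f' (projQ x) - g' (projQ x)) fE gE -raddfB.
have [W' [FW' WW']] : exists W', @calFQP _ quot_system W' /\
    forall x, W' (projP x) = projP (W x).
  suff : @calFQP R X `<=` [set W | exists W', @calFQP _ quot_system W' /\
    forall x, W' (projP x) = projP (W x)] by apply.
  apply: zspan_sub => [|_ [p [q ->]]]; last first.
    exists (@thetaP _ quot_system (projP p) (projQ q)); split.
      by apply: zspan_mem; exists (projP p), (projQ q).
    by move=> x; rewrite projPl -psiIE.
  split=> [|f g [f' [Ff fE]] [g' [Fg gE]]].
    by exists 0; split; [exact: zspan0|move=> x; rewrite [in RHS]raddf0].
  exists (f' - g'); split; first exact: zspanB.
  by move=> x; rewrite -[LHS]/(f' (projP x) - g' (projP x)) fE gE -raddfB.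
exists T', W'; split=> // [b bq|a ap].
  by rewrite -[in LHS](rQK b) TT' Tq ?rQK //; exact: map_f.
by rewrite -[in LHS](rPK a) WW' Wp ?rPK //; exact: map_f.
Qed.

Section PullBack.
Variable Y : covrep quot_system.

Let pullP_ract p r :
  (repP Y \o projP) (p <* r) = (repP Y \o projP) p * (repR Y \o rproj I) r.
Proof. by rewrite /= projPr repP_ract. Qed.
Let pullP_lact r p :
  (repP Y \o projP) (r *> p) = (repR Y \o rproj I) r * (repP Y \o projP) p.
Proof. by rewrite /= projPl repP_lact. Qed.
Let pullQ_ract q r :
  (repQ Y \o projQ) (q <* r) = (repQ Y \o projQ) q * (repR Y \o rproj I) r.
Proof. by rewrite /= projQr repQ_ract. Qed.
Let pullQ_lact r q :
  (repQ Y \o projQ) (r *> q) = (repR Y \o rproj I) r * (repQ Y \o projQ) q.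
Proof. by rewrite /= projQl repQ_lact. Qed.
Let pull_psi p q : (repR Y \o rproj I) (psi X (p \ox q)) =
  (repP Y \o projP) p * (repQ Y \o projQ) q.
Proof. by rewrite /= -psiIE -rep_psi. Qed.

Definition covrep_pull : covrep X := @CovRep R X Y
  (repP Y \o projP) (repQ Y \o projQ) (repR Y \o rproj I)
  pullP_ract pullP_lact pullQ_ract pullQ_lact pull_psi.

End PullBack.

End QuotientSystem.

Arguments quot_condFS {R X} fs {I} inv.

Record tpair (R : rngType) (X : rsystem R) (fs : condFS X) := TPair {
  tpI : rideal R;
  tpJ : rideal R;
  tp_sub : tpI `<=` tpJ;
  tp_inv : psi_invariant X tpI;
  tp_compatible : psi_compatible (quot_system fs tp_inv) (rproj_ideal tpI tpJ);
  tp_faithful : faithful (quot_system fs tp_inv) (rproj_ideal tpI tpJ)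
}.

Arguments tp_sub {R X fs} t.
Arguments tp_inv {R X fs} t.
Arguments tp_compatible {R X fs} t.
Arguments tp_faithful {R X fs} t.

(* The representation of (P, Q, psi) on the ring O attached to a T-pair.      *)
Definition calO_omega (R : rngType) (X : rsystem R) (fs : condFS X)
    (w : tpair fs) : covrep X :=
  covrep_pull (calO (quot_condFS fs (tp_inv w)) (rproj_ideal (tpI w) (tpJ w))).

Definition I_rep (R : rngType) (X : rsystem R) (Z : covrep X) : set R :=
  [set r | repR Z r = 0].

Definition J_rep (R : rngType) (X : rsystem R) (fs : condFS X) (Z : covrep X) :
  set R := [set r | range (piTS fs Z) (repR Z r)].

Definition omega_rep (R : rngType) (X : rsystem R) (fs : condFS X) (Z : covrep X) :
  set R * set R := (I_rep Z, J_rep fs Z).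

(* Main.v *)
Require Import Defs.
From HB Require Import structures.
From mathcomp Require Import all_boot ssralg ssrint.
From mathcomp Require Import boolp classical_sets functions cardinality fsbigop.

Set Implicit Arguments.
Unset Strict Implicit.
Unset Printing Implicit Defensive.
Import GRing.Theory.

Local Open Scope classical_set_scope.
Local Open Scope ring_scope.
Local Notation "x * y" := (monoid.mul x y) : ring_scope.

(* Parts (1) and (2) reduce to the quotient system: a representation killing I
   factors through it, and there sigma(x) = pi(Delta x) holds as soon as
   sigma(x) lies in the span of the T(q)S(p), because by (FS) an element of this
   span annihilating every T(q) from the left is 0.

   For (3), the equality omega = omega_rep for O itself is read off a Fock
   representation of the Toeplitz ring on multilinear functions of words in P:
   the ideal defining O maps into the operators whose values are J-valued and
   supported on words of bounded length, while sigma(r) applied to a vacuum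
   vector has as values all iterated pairings of r; faithfulness of J then kills
   r by induction on the bound.  The grading of O comes from the homomorphism to
   the operators on functions of an integer variable that sends T(q) to T(q) times
   the shift by 1, G_n being the set of b sent to b times the shift by n.
   Conversely, if the target is graded then a homogeneous y in the kernel of eta
   is 0: multiplying by S(p) on the left and by T(q) on the right lowers the degree
   or the word length, so by induction and (FS) it is enough to treat
   y = sigma(r) + f with f in the span of the T(q)S(p); then r is in J_rep = J, so
   y itself is in that span, on which eta is injective. *)

(** * Inverses of ring homomorphisms and generated ideals *)

Lemma rngmorphism_inv (A B : rngType) (f : {rngmorphism A -> B}) : bijective f ->
  exists2 g : {rngmorphism B -> A}, cancel f g & cancel g f.
Proof.
move=> [g fK gK].
have gB : zmod_morphism g.
  by move=> a b; rewrite -{1}[a]gK -{1}[b]gK -raddfB fK.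
have gM : {morph g : x y / x * y}.
  by move=> a b; rewrite -{1}[a]gK -{1}[b]gK -gmulfM fK.
pose gA := GRing.isZmodMorphism.Build _ _ _ gB.
pose gM' := monoid.isMultiplicative.Build _ _ _ gM.
pose h : {rngmorphism B -> A} := HB.pack g gA gM'.
by exists h.
Qed.

Lemma idealMz (R : rngType) (I : rideal R) x (n : int) :
  ideal_set I x -> ideal_set I (x *~ n).
Proof.
move=> Ix; have IN y : ideal_set I y -> ideal_set I (- y).
  by rewrite -[- y]sub0r; apply: idealB; exact: ideal0.
have In (k : nat) : ideal_set I (x *+ k).
  elim: k => [|k IH]; first by rewrite mulr0n; exact: ideal0.
  by rewrite mulrSr -[x in _ + x]opprK; apply: idealB => //; exact: IN.
by case: n => k; [exact: In|exact: (IN _ (In k.+1))].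
Qed.

Lemma ideal_genP (S : rngType) (A C : set S) : is_ideal C -> A `<=` C ->
  ideal_gen A `<=` C.
Proof. by move=> idC AC x; apply; split. Qed.

(** * Covariant representations and condition (FS) *)

Section Representations.
Variables (R : rngType) (X : rsystem R).
Local Notation P := (sysP X).
Local Notation Q := (sysQ X).

Lemma tensBl (p p' : P) (q : Q) : (p - p') \ox q = p \ox q - p' \ox q.
Proof. by apply/eqP; rewrite eq_sym subr_eq -tensDl subrK. Qed.
Lemma tensBr (p : P) (q q' : Q) : p \ox (q - q') = p \ox q - p \ox q'.
Proof. by apply/eqP; rewrite eq_sym subr_eq -tensDr subrK. Qed.

Lemma psi_lact r (p : P) (q : Q) : psi X ((r *> p) \ox q) = r * psi X (p \ox q).
Proof. by rewrite -lact_tens psiMl. Qed.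
Lemma psi_ract r (p : P) (q : Q) : psi X (p \ox (q <* r)) = psi X (p \ox q) * r.
Proof. by rewrite -ract_tens psiMr. Qed.

(** The additive span of these products is the range of [piTS], by [range_piTS]. Stated through the
    span, membership passes along intertwiners and is proved on generators, without naming an
    element of [calF]. *)
Definition QPset (Z : covrep X) : set Z :=
  [set z | exists q p, z = repQ Z q * repP Z p].
Arguments QPset : clear implicits.

Lemma covrep_ind (Z : covrep X) (C : set Z) : surjective_rep Z ->
  is_subring C -> (forall r, C (repR Z r)) -> (forall q, C (repQ Z q)) ->
  (forall p, C (repP Z p)) -> forall z, C z.
Proof.
move=> sZ subC CR CQ CP z; have : [set: Z] z by [].
rewrite -sZ; apply; split=> // _ [[]|] [x _ <-].
- exact: CR.
- exact: CQ.
- exact: CP.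
Qed.

Lemma intertwines_unique (Y Z : covrep X) (f g : {rngmorphism Y -> Z}) :
  surjective_rep Y -> intertwines f -> intertwines g -> f = g.
Proof.
move=> sY [fR fQ fP] [gR gQ gP]; apply: rngmorphismP.
apply: (@covrep_ind Y [set z | f z = g z]) => //.
- split=> [|x y /= xE yE]; last by rewrite /= !gmulfM /= xE yE.
  by split=> [|x y /= xE yE]; [rewrite /= !raddf0|rewrite !raddfB /= xE yE].
- by move=> r; exact: etrans (fR r) (esym (gR r)).
- by move=> r; exact: etrans (fQ r) (esym (gQ r)).
- by move=> r; exact: etrans (fP r) (esym (gP r)).
Qed.

Lemma intertwines_surjective (Y Z : covrep X) (f : {rngmorphism Y -> Z}) :
  intertwines f -> surjective_rep Y -> surjective_rep Z <-> (forall z, exists y, f y = z).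
Proof.
move=> [fR fQ fP] sY; split=> [sZ|fS].
  apply: (covrep_ind sZ).
  - split=> [|_ _ [x <-] [y <-]]; last by exists (x * y); rewrite gmulfM.
    split=> [|_ _ [x <-] [y <-]]; first by exists 0; rewrite raddf0.
    by exists (x - y); rewrite raddfB.
  - by move=> r; exists (repR Y r); exact: fR.
  - by move=> r; exists (repQ Y r); exact: fQ.
  - by move=> r; exists (repP Y r); exact: fP.
apply/seteqP; split=> // z _ C [[[C0 CB] CM] gC]; have [y <-] := fS z.
move: y {z}; apply: (covrep_ind sY).
- split=> [|x y Cx Cy]; last by rewrite /= gmulfM; exact: CM.
  by split=> [|x y Cx Cy] /=; [rewrite raddf0|rewrite raddfB; exact: CB].
- by move=> r; apply: gC; left; left; exists r => //; exact: esym (fR r).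
- by move=> r; apply: gC; left; right; exists r => //; exact: esym (fQ r).
- by move=> r; apply: gC; right; exists r => //; exact: esym (fP r).
Qed.

Lemma intertwines_comp (Y Z W : covrep X) (g : Z -> W) (f : Y -> Z) :
  intertwines f -> intertwines g -> intertwines (g \o f).
Proof.
move=> [fR fQ fP] [gR gQ gP]; split=> x /=.
- by rewrite -gR /=; congr g; exact: fR.
- by rewrite -gQ /=; congr g; exact: fQ.
- by rewrite -gP /=; congr g; exact: fP.
Qed.

Lemma QPset_intertwines (Y Z : covrep X) (f : {rngmorphism Y -> Z}) y :
  intertwines f -> zspan (QPset Y) y -> zspan (QPset Z) (f y).
Proof.
move=> [_ fQ fP]; suff : zspan (QPset Y) `<=` [set y | zspan (QPset Z) (f y)] by apply.
apply: zspan_sub => [|_ [q [p ->]]]; last first.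
  by rewrite /= gmulfM; apply: zspan_mem; exists q, p; rewrite -fQ -fP.
split=> /= [|a b a_ b_]; first by rewrite raddf0; exact: zspan0.
by rewrite raddfB; exact: zspanB.
Qed.

Section FS.
Hypothesis fs : condFS X.

(** By (FS), q is fixed by some element of [calFPQ], and each theta_{q',p} sends q to q' psi(p ⊗ q)
    = 0. Thus psi is nondegenerate on the side of Q. *)
Lemma Q_eq0 (q : Q) : (forall p : P, psi X (p \ox q) = 0) -> q = 0.
Proof.
move=> q0; have [T [_ [FT _ Tq _]]] := fs [:: q] [::].
rewrite -(Tq q (mem_head _ _)).
suff : @calFPQ R X `<=` [set T | T q = 0] by apply.
apply: zspan_sub => [|_ [q' [p ->]]]; last by rewrite /= /thetaQ q0 ract0r.
by split=> // f g f0 g0; rewrite /= -[LHS]/(f q - g q) f0 g0 subrr.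
Qed.

Lemma P_eq0 (p : P) : (forall q : Q, psi X (p \ox q) = 0) -> p = 0.
Proof.
move=> p0; have [_ [T [_ FT _ Tp]]] := fs [::] [:: p].
rewrite -(Tp p (mem_head _ _)).
suff : @calFQP R X `<=` [set T | T p = 0] by apply.
apply: zspan_sub => [|_ [p' [q ->]]]; last by rewrite /= /thetaP p0 lact0l.
by split=> // f g f0 g0; rewrite /= -[LHS]/(f p - g p) f0 g0 subrr.
Qed.

Lemma calF_thetas (C : set (calF X)) : is_subgroup C ->
  (forall q p, C (theta q p)) -> forall f, C f.
Proof.
move=> [C0 CB] Ct f.
suff : @calFPQ R X `<=` [set h | exists2 g, C g & g = h :> (Q -> Q)].
  by case/(_ _ (calFP f)) => g Cg gf; rewrite -(val_inj gf).
apply: zspan_sub => [|_ [q [p ->]]]; last by exists (theta q p).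
split=> [|_ _ [g Cg <-] [h Ch <-]]; first by exists 0.
by exists (g - h); first exact: CB.
Qed.

Lemma range_piTS (Z : covrep X) : range (piTS fs Z) = zspan (QPset Z).
Proof.
apply/seteqP; split=> [_ [f _ <-]|]; last first.
  apply: zspan_sub => [|_ [q [p ->]]].
    split=> [|_ _ [f _ <-] [g _ <-]]; first by exists 0 => //; rewrite raddf0.
    by exists (f - g) => //; rewrite raddfB.
  by exists (theta q p) => //; exact: piTS_theta.
apply: (@calF_thetas [set f | zspan (QPset Z) (piTS fs Z f)]) => [|q p].
  split=> [|g h Fg Fh] /=; first by rewrite raddf0; exact: zspan0.
  by rewrite raddfB; exact: zspanB.
by rewrite /= piTS_theta; apply: zspan_mem; exists q, p.
Qed.

Lemma piTS_repQ (Z : covrep X) f q : piTS fs Z f * repQ Z q = repQ Z (f q).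
Proof.
apply: (@calF_thetas [set f | piTS fs Z f * repQ Z q = repQ Z (f q)]) => [|q' p].
  split=> [|g h Fg Fh] /=; first by rewrite raddf0 rng0M raddf0.
  by rewrite raddfB rngMBl Fg Fh -raddfB.
by rewrite /= piTS_theta -mulgA -rep_psi -repQ_ract.
Qed.

Lemma piTS_repR (Z : covrep X) f r : zspan (QPset Z) (piTS fs Z f * repR Z r).
Proof.
apply: (@calF_thetas [set f | zspan (QPset Z) (piTS fs Z f * repR Z r)]) => [|q' p].
  split=> [|g h Fg Fh] /=; first by rewrite raddf0 rng0M; exact: zspan0.
  by rewrite raddfB rngMBl; exact: zspanB.
rewrite /= piTS_theta -mulgA -repP_ract.
by apply: zspan_mem; exists q', (p <* r).
Qed.

Lemma piTS_intertwines (Y Z : covrep X) (f : {rngmorphism Y -> Z}) g :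
  intertwines f -> f (piTS fs Y g) = piTS fs Z g.
Proof.
case=> _ fQ fP; apply: (@piTS_unique _ _ fs Z (f \o piTS fs Y)) => q p /=.
by rewrite piTS_theta gmulfM -fQ -fP.
Qed.

(** Right multiplication by pi(f) is adjoint to f: S(p) pi(f) = S(g) for some g with psi(g ⊗ q) =
    psi(p ⊗ f(q)) for all q. If f is Delta(r), this is psi(pr ⊗ q), and [P_eq0] gives g = pr. *)
Lemma repP_piTS_Delta (Z : covrep X) (f : calF X) r p :
  f = Delta r :> (Q -> Q) -> repP Z p * piTS fs Z f = repP Z (p <* r).
Proof.
move=> fE; have [g gp gE] : exists2 g : P, (forall q, psi X (g \ox q) = psi X (p \ox f q)) &
    repP Z p * piTS fs Z f = repP Z g.
  apply: (@calF_thetas [set f : calF X | exists2 g : P,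
    (forall q, psi X (g \ox q) = psi X (p \ox f q)) &
    repP Z p * piTS fs Z f = repP Z g]) => [|q' p'].
    split=> [|h k [a aE ha] [b bE kb]].
      exists 0; last by rewrite [RHS]raddf0 [piTS _ _ _]raddf0 rngM0.
      move=> q; rewrite -(subrr (0 : P)) tensBl subrr.
      by rewrite -[(0 : calF X) q]/(0 : Q) -(subrr (0 : Q)) tensBr subrr.
    exists (a - b); last by rewrite raddfB rngMBr ha kb -raddfB.
    by move=> q; rewrite tensBl raddfB aE bE -raddfB -tensBr.
  exists (psi X (p \ox q') *> p'); last first.
    by rewrite piTS_theta mulgA -rep_psi -repP_lact.
  by move=> q; rewrite psi_lact -psi_ract.
rewrite gE; congr (repP Z _); apply/eqP; rewrite -subr_eq0; apply/eqP/P_eq0 => q.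
by rewrite tensBl raddfB gp fE /Delta tens_balanced subrr.
Qed.

Lemma QP_left_unit (Z : covrep X) (qs : seq Q) :
  exists2 e, zspan (QPset Z) e & {in qs, forall q, e * repQ Z q = repQ Z q}.
Proof.
have [T [_ [FT _ Tq _]]] := fs qs [::].
pose f := CalF (asboolT FT); exists (piTS fs Z f).
  by rewrite -range_piTS; exists f.
by move=> q qqs; rewrite piTS_repQ /= Tq.
Qed.

(** Since S(y)T(q)S(p) = S(theta_{p,q}(y)), every operator of [calFQP] is realised as right
    multiplication by an element of the span; (FS) provides an operator fixing the given vectors. *)
Lemma QP_right_unit (Z : covrep X) (ps : seq P) :
  exists2 e, zspan (QPset Z) e & {in ps, forall p, repP Z p * e = repP Z p}.
Proof.
have [_ [W [_ FW _ Wp]]] := fs [::] ps.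
suff [e eF eW] : exists2 e, zspan (QPset Z) e & forall p, repP Z p * e = repP Z (W p).
  by exists e => // p pps; rewrite eW Wp.
move: W FW {Wp}; suff : @calFQP R X `<=` [set W | exists2 e, zspan (QPset Z) e &
    forall p, repP Z p * e = repP Z (W p)] by [].
apply: zspan_sub => [|_ [p [q ->]]]; last first.
  exists (repQ Z q * repP Z p); first by apply: zspan_mem; exists q, p.
  by move=> p'; rewrite mulgA -rep_psi -repP_lact.
split=> [|f g [e Fe eE] [e' Fe' eE']].
  by exists 0; [exact: zspan0|move=> p; rewrite rngM0 raddf0].
by exists (e - e'); [exact: zspanB|move=> p; rewrite rngMBr eE eE' -raddfB].
Qed.

(* (FS) gives a right unit e of z in the span of the T(q)S(p), and z e = 0.      *)
Lemma QP_ann0 (Z : covrep X) z : zspan (QPset Z) z ->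
  (forall q, z * repQ Z q = 0) -> z = 0.
Proof.
move=> Fz z0.
have [ps psP] : exists ps : seq P, forall e,
    {in ps, forall p, repP Z p * e = repP Z p} -> z * e = z.
  move: z Fz {z0}; suff : zspan (QPset Z) `<=` [set z | exists ps : seq P, forall e,
    {in ps, forall p, repP Z p * e = repP Z p} -> z * e = z] by [].
  apply: zspan_sub => [|_ [q [p ->]]]; last first.
    by exists [:: p] => e eP; rewrite -mulgA eP ?mem_head.
  split=> [|x y [s sP] [t tP]]; first by exists [::] => e _; rewrite rng0M.
  exists (s ++ t) => e eP; rewrite rngMBl sP ?tP // => p ps; apply: eP.
    by rewrite mem_cat ps orbT.
  by rewrite mem_cat ps.
have [e Fe eP] := QP_right_unit Z ps; rewrite -(psP e eP).
suff : zspan (QPset Z) `<=` [set e | z * e = 0] by apply.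
apply: zspan_sub => [|_ [q [p ->]]]; last by rewrite /= mulgA z0 rng0M.
by split=> /= [|x y x0 y0]; rewrite ?rngM0 // rngMBr x0 y0 subrr.
Qed.

(** Both sides send T(q) to T(rq) by left multiplication, and their difference lies in the span, so
    [QP_ann0] applies. *)
Lemma repR_eq_piTS (Z : covrep X) r (f : calF X) : zspan (QPset Z) (repR Z r) ->
  f = Delta r :> (Q -> Q) -> repR Z r = piTS fs Z f.
Proof.
move=> Fr fE; apply/eqP; rewrite -subr_eq0; apply/eqP/QP_ann0 => [|q].
  by apply: zspanB => //; rewrite -range_piTS; exists f.
by rewrite rngMBl piTS_repQ fE -repQ_lact subrr.
Qed.

(** * The relative Cuntz-Pimsner ring and its universal property *)

Section CalO.
Variable J : rideal R.

Lemma rproj_intertwines :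
  intertwines (rproj (calT fs J) : toeplitz X -> calO fs J).
Proof. by []. Qed.

Lemma calO_surjective : surjective_rep (calO fs J).
Proof.
apply/seteqP; split=> // a _; have [x <-] := rproj_surj a => C [[[C0 CB] CM] AC].
apply: (@covrep_ind (toeplitz X) [set x | C (rproj (calT fs J) x)]).
- exact: toeplitz_surjective.
- split=> [|y z Cy Cz]; last by rewrite /= gmulfM; exact: CM.
  by split=> [|y z Cy Cz] /=; [rewrite raddf0|rewrite raddfB; exact: CB].
- by move=> r; apply: AC; left; left; exists r.
- by move=> r; apply: AC; left; right; exists r.
- by move=> r; apply: AC; right; exists r.
Qed.

Lemma calO_rel r (f : calF X) : ideal_set J r -> f = Delta r :> (Q -> Q) ->
  repR (calO fs J) r = piTS fs (calO fs J) f.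
Proof.
move=> Jr fE; rewrite -(piTS_intertwines f rproj_intertwines).
apply/rprojP => C [idC]; apply; exists r, f; split => //.
Qed.

Lemma calO_span r : psi_compatible X J -> ideal_set J r ->
  zspan (QPset (calO fs J)) (repR (calO fs J) r).
Proof.
move=> JF Jr; pose f := CalF (asboolT (JF r Jr) : zspan_pred (thetasQ (X := X)) (Delta r)).
by rewrite (@calO_rel r f) // -range_piTS; exists f.
Qed.

(** The assumption on J is mere membership in the span; [repR_eq_piTS] upgrades it to sigma(x) =
    pi(Delta x), so the homomorphism from the Toeplitz ring kills the generators of [calT]. *)
Lemma calO_lift (Z : covrep X) :
  psi_compatible X J -> (forall r, ideal_set J r -> zspan (QPset Z) (repR Z r)) ->
  exists eta : {rngmorphism calO fs J -> Z}, intertwines eta.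
Proof.
move=> JF JZ; have [eta [etaI _]] := toeplitz_universal Z.
have eta0 a : ideal_set (calT fs J) a -> eta a = 0.
  suff : calT fs J `<=` [set a | eta a = 0] by apply.
  apply: ideal_genP => [|_ [x [f [Jx fE ->]]]].
    split=> [|y x /= x0]; last by rewrite !gmulfM /= x0 rngM0 rng0M.
    by split=> [|x y] /=; [rewrite raddf0|rewrite raddfB /= => -> ->; rewrite subrr].
  have [etaR _ _] := etaI; rewrite /= raddfB; apply/eqP; rewrite subr_eq0; apply/eqP.
  rewrite [RHS](piTS_intertwines (Y := toeplitz X) f etaI).
  by rewrite -(repR_eq_piTS (JZ x Jx) fE) -etaR.
pose g : calO fs J -> Z := quotlift eta0.
have gE a : g (rproj (calT fs J) a) = eta a by exact: quotliftE.
have gB : zmod_morphism g by move=> a b; exact: raddfB.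
have gM : {morph g : x y / x * y}.
  move=> a b; have [x <-] := rproj_surj a; have [y <-] := rproj_surj b.
  by rewrite -gmulfM !gE gmulfM.
pose gA := GRing.isZmodMorphism.Build _ _ _ gB.
pose gM' := monoid.isMultiplicative.Build _ _ _ gM.
pose h : {rngmorphism calO fs J -> Z} := HB.pack g gA gM'.
by exists h; case: etaI => eR eQ eP; split=> x;
  [exact: etrans (gE _) (eR x)|exact: etrans (gE _) (eQ x)|exact: etrans (gE _) (eP x)].
Qed.

End CalO.
End FS.
End Representations.
Arguments QPset {R X} Z.

(** * The Fock representation *)

Section Endomorphisms.
Variable U : zmodType.

Definition endo_pred : {pred U -> U} := fun f => `[< zmod_morphism f >].

Lemma endo_pred_closed : zmod_closed endo_pred.
Proof.
split=> [|f g]; rewrite !unfold_in; first by apply/asboolP => x y; rewrite [RHS]subr0.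
move=> /asboolP fB /asboolP gB; apply/asboolP => x y.
rewrite -[LHS]/(f (x - y) - g (x - y)) -[RHS]/((f x - g x) - (f y - g y)).
by rewrite fB gB !opprD !opprK addrACA.
Qed.
HB.instance Definition _ := GRing.isZmodClosed.Build (U -> U) endo_pred endo_pred_closed.

Record endo := Endo { endo_fun :> U -> U; endo_mem : endo_pred endo_fun }.
HB.instance Definition _ := [isSub for endo_fun].
HB.instance Definition _ := [Choice of endo by <:].
HB.instance Definition _ := [SubChoice_isSubZmodule of endo by <:].

Lemma endoB (f : endo) : zmod_morphism f.
Proof. exact/asboolP/endo_mem. Qed.

Lemma endoD (f : endo) : {morph f : x y / x + y}.
Proof.
have f0 : f 0 = 0 by rewrite -(subrr 0) endoB !subrr.
move=> x y; have fN : f (- y) = - f y by rewrite -sub0r endoB f0 sub0r.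
by rewrite -[y in LHS]opprK endoB fN opprK.
Qed.

Lemma endoP (f g : endo) : f =1 g -> f = g.
Proof. by move=> fg; apply: val_inj; apply: funext. Qed.

Lemma endo_comp_subproof (f g : endo) : endo_pred (f \o g).
Proof. by apply/asboolP => x y /=; rewrite !endoB. Qed.
Definition endo_comp (f g : endo) : endo := Endo (endo_comp_subproof f g).

Let endo_compA : associative endo_comp.
Proof. by move=> f g h; apply: val_inj. Qed.
Let endo_compDl : left_distributive endo_comp +%R.
Proof. by move=> f g h; apply: val_inj. Qed.
Let endo_compDr : right_distributive endo_comp +%R.
Proof. by move=> f g h; apply: endoP => x; exact: endoD. Qed.
HB.instance Definition _ := Zmodule_isRng.Build endo endo_compA endo_compDl endo_compDr.

Definition mkendo (f : U -> U) (fB : zmod_morphism f) : endo := Endo (asboolT fB).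

End Endomorphisms.

(* R with a unit adjoined: (r, n) stands for r + n, so that 1 = (0, 1) is a     *)
(* vector on which R acts faithfully even if R has no unit.                     *)
Definition unitz (R : rngType) : Type := (R * int)%type.
HB.instance Definition _ (R : rngType) := GRing.Zmodule.on (unitz R).

Section Unitization.
Variable R : rngType.
Local Notation U := (unitz R).

Definition unitz_lact (r : R) (m : U) : U := (r * m.1 + r *~ m.2, 0).
Definition unitz_ract (m : U) (r : R) : U := (m.1 * r + r *~ m.2, 0).

Let rngMz (r s : R) (n : int) : r * (s *~ n) = (r * s) *~ n.
Proof.
have rB : zmod_morphism (fun x => r * x) by move=> x y; exact: rngMBr.
pose f : {additive R -> R} := HB.pack (fun x => r * x) (GRing.isZmodMorphism.Build _ _ _ rB).
exact: (raddfMz f).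
Qed.
Let rngzM (r s : R) (n : int) : (r *~ n) * s = (r * s) *~ n.
Proof.
have rB : zmod_morphism (fun x => x * s) by move=> x y; exact: rngMBl.
pose f : {additive R -> R} := HB.pack (fun x => x * s) (GRing.isZmodMorphism.Build _ _ _ rB).
exact: (raddfMz f).
Qed.

Let lDl r s m : unitz_lact (r + s) m = unitz_lact r m + unitz_lact s m.
Proof. by congr pair; rewrite ?addr0 // rngMDl mulrzDl addrACA. Qed.
Let lDr r m n : unitz_lact r (m + n) = unitz_lact r m + unitz_lact r n.
Proof. by congr pair; rewrite ?addr0 // rngMDr mulrzDr addrACA. Qed.
Let lM r s m : unitz_lact (r * s) m = unitz_lact r (unitz_lact s m).
Proof. by congr pair; rewrite /= mulr0z addr0 rngMDr mulgA rngMz. Qed.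
Let rDl m n r : unitz_ract (m + n) r = unitz_ract m r + unitz_ract n r.
Proof. by congr pair; rewrite ?addr0 // rngMDl mulrzDr addrACA. Qed.
Let rDr m r s : unitz_ract m (r + s) = unitz_ract m r + unitz_ract m s.
Proof. by congr pair; rewrite ?addr0 // rngMDr mulrzDl addrACA. Qed.
Let rM m r s : unitz_ract m (r * s) = unitz_ract (unitz_ract m r) s.
Proof. by congr pair; rewrite /= mulr0z addr0 rngMDl mulgA rngzM. Qed.
Let lrA r m s : unitz_lact r (unitz_ract m s) = unitz_ract (unitz_lact r m) s.
Proof. by congr pair; rewrite /= !mulr0z !addr0 rngMDr rngMDl mulgA rngMz rngzM. Qed.

HB.instance Definition _ := Zmodule_isBimod.Build R U lDl lDr lM rDl rDr rM lrA.

End Unitization.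

Section FunctionBimodule.
Variables (R : rngType) (T : Type) (M : bimodType R).

Let lactF (r : R) (f : T -> M) : T -> M := fun t => r *> f t.
Let ractF (f : T -> M) (r : R) : T -> M := fun t => f t <* r.

Let lDl r s f : lactF (r + s) f = lactF r f + lactF s f.
Proof. by apply/funeqP => t; exact: lactDl. Qed.
Let lDr r f g : lactF r (f + g) = lactF r f + lactF r g.
Proof. by apply/funeqP => t; exact: lactDr. Qed.
Let lM r s f : lactF (r * s) f = lactF r (lactF s f).
Proof. by apply/funeqP => t; exact: lactM. Qed.
Let rDl f g r : ractF (f + g) r = ractF f r + ractF g r.
Proof. by apply/funeqP => t; exact: ractDl. Qed.
Let rDr f r s : ractF f (r + s) = ractF f r + ractF f s.
Proof. by apply/funeqP => t; exact: ractDr. Qed.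
Let rM f r s : ractF f (r * s) = ractF (ractF f r) s.
Proof. by apply/funeqP => t; exact: ractM. Qed.
Let lrA r f s : lactF r (ractF f s) = ractF (lactF r f) s.
Proof. by apply/funeqP => t; exact: lractA. Qed.

HB.instance Definition _ := Zmodule_isBimod.Build R (T -> M) lDl lDr lM rDl rDr rM lrA.

End FunctionBimodule.

(* Instead of the sum of the Q^(\ox n) \ox M, the space of all v : seq P -> M    *)
(* that are multilinear and balanced: on words of length n such a v is an        *)
(* element of Hom_R(P, Hom_R(P, ... M)).  No tensor product is then needed.       *)
Section Fock.
Variables (R : rngType) (X : rsystem R) (M : bimodType R).
Local Notation P := (sysP X).
Local Notation Q := (sysQ X).
Implicit Types (v : seq P -> M) (r s : R) (p : P) (q : Q) (w u : seq P).

(** On left linear maps from P to N the action is (r v)(p) = v(pr), so r is absorbed by the first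
    letter; the action of M is used only on the empty word. *)
Definition focklact r v w : M :=
  if w is p :: w' then v ((p <* r) :: w') else r *> v [::].
Definition fockanni p v w : M := v (p :: w).
Definition fockcrea q v w : M :=
  if w is p :: w' then focklact (psi X (p \ox q)) v w' else 0.

(** The second clause is linearity in each letter: a scalar to the left of a letter moves to the
    next letter, or into M at the end of the word. *)
Definition fock_rel v :=
  (forall u p p' w, v (u ++ (p + p') :: w) = v (u ++ p :: w) + v (u ++ p' :: w)) /\
  (forall u r p w, v (u ++ (r *> p) :: w) = focklact r (fun w => v (u ++ p :: w)) w).

Lemma focklactM r s v : focklact (r * s) v = focklact r (focklact s v).
Proof. by apply/funeqP => -[|p w] /=; rewrite ?lactM ?ractM. Qed.

Lemma focklactD r s v w : fock_rel v ->
  focklact (r + s) v w = focklact r v w + focklact s v w.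
Proof.
by move=> [vD _]; case: w => [|p w] /=; rewrite ?lactDl // ractDr (vD [::]).
Qed.

Lemma fockcreaD q q' v w : fock_rel v ->
  fockcrea (q + q') v w = fockcrea q v w + fockcrea q' v w.
Proof.
move=> vF; case: w => [|p w] /=; first by rewrite addr0.
by rewrite tensDr raddfD focklactD.
Qed.

Lemma focklact_rel r v : fock_rel v -> fock_rel (focklact r v).
Proof.
move=> [vD vl]; split=> [[|p0 u] p p' w|[|p0 u] s p w] /=.
- by rewrite ractDl (vD [::]).
- exact: (vD (_ :: u)).
- by rewrite -lractA (vl [::]).
- exact: (vl (_ :: u)).
Qed.

Lemma fockanni_rel p v : fock_rel v -> fock_rel (fockanni p v).
Proof.
by move=> [vD vl]; split=> [u p1 p2 w|u s p1 w]; [exact: (vD (_ :: u))|exact: (vl (_ :: u))].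
Qed.

Lemma fockcrea_rel q v : fock_rel v -> fock_rel (fockcrea q v).
Proof.
move=> vF; split=> [[|p0 u] p p' w|[|p0 u] s p w] /=.
- by rewrite tensDl raddfD focklactD.
- by case: (focklact_rel (psi X (p0 \ox q)) vF) => vD _; exact: vD.
- by rewrite psi_lact focklactM.
- by case: (focklact_rel (psi X (p0 \ox q)) vF) => _ vl; exact: vl.
Qed.

Lemma focklactB r : zmod_morphism (focklact r).
Proof. by move=> v v'; apply/funeqP => -[|p w] //; exact: lactBr. Qed.
Lemma fockanniB p : zmod_morphism (fockanni p).
Proof. by []. Qed.
Lemma fockcreaB q : zmod_morphism (fockcrea q).
Proof.
move=> v v'; apply/funeqP => -[|p w]; first by rewrite [RHS]subr0.
by rewrite /= focklactB.
Qed.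

Definition fock_pred : {pred seq P -> M} := fun v => `[< fock_rel v >].

Lemma fock_pred_closed : zmod_closed fock_pred.
Proof.
split=> [|v v']; rewrite !unfold_in.
  apply/asboolP; split=> [u p p' w|u r p w]; first by rewrite [RHS]addr0.
  by case: w => //=; rewrite lact0r.
move=> /asboolP[vD vl] /asboolP[vD' vl']; apply/asboolP; split=> [u p p' w|u r p w].
  rewrite -[LHS]/(v _ - v' _) vD vD' opprD addrACA //.
rewrite -[LHS]/(v _ - v' _) vl vl'.
by case: w => //; rewrite /= -lactBr.
Qed.
HB.instance Definition _ := GRing.isZmodClosed.Build (seq P -> M) fock_pred fock_pred_closed.

Record fock := Fock { fock_fun :> seq P -> M; fock_mem : fock_pred fock_fun }.
HB.instance Definition _ := [isSub for fock_fun].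
HB.instance Definition _ := [Choice of fock by <:].
HB.instance Definition _ := [SubChoice_isSubZmodule of fock by <:].

Lemma fock_memP (v : fock) : fock_rel v.
Proof. exact/asboolP/fock_mem. Qed.

Lemma fock_ext (v v' : fock) : v =1 v' -> v = v'.
Proof. by move=> vv'; apply: val_inj; apply: funext. Qed.

Section Operators.
Variables (op : (seq P -> M) -> (seq P -> M)).
Hypotheses (opF : forall v, fock_rel v -> fock_rel (op v)) (opB : zmod_morphism op).
Definition fock_op_fun (v : fock) : fock := Fock (asboolT (opF (fock_memP v))).
Lemma fock_op_zmod : zmod_morphism fock_op_fun.
Proof. by move=> v v'; apply: val_inj; exact: opB. Qed.
Definition fock_op : endo fock := mkendo fock_op_zmod.
End Operators.

Definition fockR r : endo fock := fock_op (@focklact_rel r) (focklactB r).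
Definition fockP p : endo fock := fock_op (@fockanni_rel p) (fockanniB p).
Definition fockQ q : endo fock := fock_op (@fockcrea_rel q) (fockcreaB q).

Let additiveP (V W : zmodType) (f : V -> W) :
  {morph f : x y / x + y} -> zmod_morphism f.
Proof. by move=> fD x y; apply: (@addIr _ (f y)); rewrite subrK -fD subrK. Qed.

Let fockR_zmod : zmod_morphism fockR.
Proof.
apply: additiveP => r s; apply: endoP => v; apply: fock_ext => w.
exact: (focklactD r s w (fock_memP v)).
Qed.
Let fockP_zmod : zmod_morphism fockP.
Proof.
apply: additiveP => r s; apply: endoP => v; apply: fock_ext => w.
exact: ((fock_memP v).1 [::]).
Qed.
Let fockQ_zmod : zmod_morphism fockQ.
Proof.
apply: additiveP => r s; apply: endoP => v; apply: fock_ext => w.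
exact: (fockcreaD r s w (fock_memP v)).
Qed.
Let fockR_mul : {morph fockR : r s / r * s}.
Proof.
by move=> r s; apply: endoP => v; apply: val_inj; exact: focklactM.
Qed.
HB.instance Definition _ := GRing.isZmodMorphism.Build R (endo fock) fockR fockR_zmod.
HB.instance Definition _ := GRing.isZmodMorphism.Build P (endo fock) fockP fockP_zmod.
HB.instance Definition _ := GRing.isZmodMorphism.Build Q (endo fock) fockQ fockQ_zmod.
HB.instance Definition _ := monoid.isMultiplicative.Build R (endo fock) fockR fockR_mul.

Let fockP_ract p r : fockP (p <* r) = fockP p * fockR r.
Proof. by apply: endoP => v; apply: fock_ext => w. Qed.
Let fockP_lact r p : fockP (r *> p) = fockR r * fockP p.
Proof.
by apply: endoP => v; apply: fock_ext => w; exact: ((fock_memP v).2 [::]).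
Qed.
Let fockQ_ract q r : fockQ (q <* r) = fockQ q * fockR r.
Proof.
apply: endoP => v; apply: fock_ext => -[|p w] //.
rewrite -[LHS]/(focklact (psi X (p \ox (q <* r))) v w) psi_ract.
by rewrite focklactM.
Qed.
Let fockQ_lact r q : fockQ (r *> q) = fockR r * fockQ q.
Proof.
apply: endoP => v; apply: fock_ext => -[|p w]; first by rewrite [RHS]lact0r.
rewrite -[LHS]/(focklact (psi X (p \ox (r *> q))) v w).
by rewrite -tens_balanced.
Qed.
Let fock_psi p q : fockR (psi X (p \ox q)) = fockP p * fockQ q.
Proof. by apply: endoP => v; apply: fock_ext => w. Qed.

Definition fock_rep : covrep X := @CovRep R X (endo fock) fockP fockQ fockR
  fockP_ract fockP_lact fockQ_ract fockQ_lact fock_psi.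

Lemma fock_repB (a b : fock_rep) (v : fock) w :
  ((a - b : fock_rep) : endo fock) v w = (a : endo fock) v w - (b : endo fock) v w.
Proof. by []. Qed.

Lemma fock_rep_ann0 (a : fock_rep) p (v : fock) w :
  repP fock_rep p * a = 0 -> (a : endo fock) v (p :: w) = 0.
Proof. by move/(congr1 (fun b : endo fock => b v w)). Qed.

End Fock.

(** * Iterated pairings and the vacuum vector *)

Section Vacuum.
Variables (R : rngType) (X : rsystem R).
Local Notation P := (sysP X).
Local Notation Q := (sysQ X).
Local Notation M := (seq Q -> unitz R).
Implicit Types (m : unitz R).

Definition unitz_act m (q : Q) : Q := m.1 *> q + q *~ m.2.

Lemma unitz_act_lact r m q : unitz_act (r *> m) q = r *> unitz_act m q.
Proof.
rewrite /unitz_act /= mulr0z addr0 lactDl lactDr lactM; congr (_ + _).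
have lB : zmod_morphism (fun x : Q => r *> x) by move=> x y; exact: lactBr.
have rB : zmod_morphism (fun x : R => x *> q) by move=> x y; exact: lactBl.
pose f : {additive Q -> Q} := HB.pack (fun x : Q => r *> x) (GRing.isZmodMorphism.Build _ _ _ lB).
pose g : {additive R -> Q} := HB.pack (fun x : R => x *> q) (GRing.isZmodMorphism.Build _ _ _ rB).
exact: etrans (raddfMz g _ _) (esym (raddfMz f _ _)).
Qed.

(* <p1 ... pn | m | q1 ... qn> is the product S(pn)...S(p1) m T(q1)...T(qn); the  *)
(* words in Q merely index a family of vectors, so that a bound on the support   *)
(* is uniform over all q1 ... qn.                                                *)
Fixpoint pairing m (ps : seq P) (qs : seq Q) : unitz R :=
  match ps, qs with
  | [::], [::] => m
  | p :: ps', q :: qs' => pairing (psi X (p \ox unitz_act m q), 0) ps' qs'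
  | _, _ => 0
  end.

Lemma pairingD m m' ps qs : pairing (m + m') ps qs = pairing m ps qs + pairing m' ps qs.
Proof.
elim: ps m m' qs => [|p ps IH] m m' [|q qs] //=; rewrite ?addr0 //.
rewrite -IH; congr (pairing (_, _) ps qs).
by rewrite /= -raddfD -tensDr /unitz_act lactDl mulrzDr addrACA.
Qed.

Lemma focklact_pairing r m : focklact (X := X) r (pairing m : seq P -> M) = pairing (r *> m).
Proof.
apply/funeqP => -[|p w]; apply/funeqP => -[|q qs] //=.
- by rewrite -[LHS]/(r *> (0 : unitz R)) lact0r.
- by rewrite unitz_act_lact tens_balanced.
Qed.

Lemma focklact_at r (v v' : seq P -> M) w qs qs' :
  (forall u, v u qs = v' u qs') -> focklact r v w qs = focklact r v' w qs'.
Proof.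
move=> vv'; case: w => [|p w] /=; last exact: vv'.
by rewrite -[LHS]/(r *> v [::] qs) vv'.
Qed.

Lemma pairing_rel m : fock_rel (pairing m : seq P -> M).
Proof.
split=> u.
  elim: u m => [|p0 u IH] m p p' w; apply/funeqP => -[|q qs] //=.
  - by rewrite [RHS]addr0.
  - rewrite -[RHS]/(pairing _ w qs + pairing _ w qs) -pairingD tensDl raddfD.
    by congr (pairing (_, _) w qs).
  - by rewrite [RHS]addr0.
  - by rewrite IH.
elim: u m => [|p0 u IH] m r p w; apply/funeqP => -[|q qs] //=.
- case: w => //=; exact: (esym (lact0r (unitz R) r)).
- rewrite psi_lact; set s := psi X _.
  have -> : (r * s, 0) = r *> ((s, 0) : unitz R) :> unitz R.
    by congr pair; rewrite /= mulr0z addr0.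
  by rewrite -focklact_pairing; exact: focklact_at.
- case: w => //=; exact: (esym (lact0r (unitz R) r)).
- by rewrite IH; exact: focklact_at.
Qed.

(** The component indexed by the empty word in Q is the vacuum proper: it is supported on the empty
    word, with value 1. The component indexed by q1 ... qn is T(q1)...T(qn) applied to it. *)
Definition vacuum : fock X M := Fock (asboolT (pairing_rel (0, 1))).

Lemma fockR_vacuum r : fockR X M r vacuum = pairing (r, 0) :> (seq P -> M).
Proof.
rewrite -[LHS]/(focklact r (pairing (0, 1))) focklact_pairing.
by congr pairing; congr pair; rewrite /= rngM0 add0r mulr1z.
Qed.

(** Induction on N: the pairings of psi(p ⊗ rq) are those of r on words one letter longer, so they
    vanish from length N on and psi(p ⊗ rq) = 0. Hence Delta(r) = 0 by [Q_eq0], while r is in J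
    because it is its own pairing on empty words. *)
Lemma pairing_faithful (fs : condFS X) (J : rideal R) : faithful X J ->
  forall N r, (forall ps qs, ideal_set J (pairing (r, 0) ps qs).1) ->
  (forall ps qs, N <= size ps -> pairing (r, 0) ps qs = 0) -> r = 0.
Proof.
move=> JF; elim=> [|N IH] r rJ rN; first by have [] := rN [::] [::] isT.
have pE p q : pairing (r, 0) [:: p] [:: q] = (psi X (p \ox (r *> q)), 0).
  by rewrite /= /unitz_act mulr0z addr0.
suff : (J `&` [set r | Delta r = 0 :> (Q -> Q)]) r by rewrite JF.
split; first exact: (rJ [::] [::]).
apply/funeqP => q; apply: (Q_eq0 fs) => p; apply: IH => [ps qs|ps qs Nps].
  by have := rJ (p :: ps) (q :: qs); rewrite /= /unitz_act mulr0z addr0.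
by have := rN (p :: ps) (q :: qs) Nps; rewrite /= /unitz_act mulr0z addr0.
Qed.

End Vacuum.

(** * The ideal [calT] in the Fock representation *)

Section CuntzPimsnerFock.
Variables (R : rngType) (X : rsystem R) (fs : condFS X) (J : rideal R).
Local Notation P := (sysP X).
Local Notation Q := (sysQ X).
Local Notation M := (seq Q -> unitz R).
Local Notation F := (fock X M).

(** J sits in the unitization as the pairs (x, 0), hence the vanishing second coordinate. The bound
    on the length does not depend on the index [qs], since [v w = 0] is an equality of families. *)
Definition fock_null (v : F) : Prop :=
  (forall w qs, ideal_set J (v w qs).1 /\ (v w qs).2 = 0) /\
  exists N, forall w, N <= size w -> v w = 0.

Lemma fock_null_subgroup : is_subgroup fock_null.
Proof.
split=> [|x y [xJ [N xN]] [yJ [N' yN]]].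
  by split; [split=> //; exact: ideal0|exists 0].
split=> [w qs|].
  have [[xJ1 x2] [yJ1 y2]] := (xJ w qs, yJ w qs).
  rewrite -[(x - y) w qs]/((x w qs).1 - (y w qs).1, (x w qs).2 - (y w qs).2).
  by split; [exact: idealB|rewrite /= x2 y2 subrr].
exists (maxn N N') => w; rewrite geq_max => /andP[Nw N'w].
by rewrite -[LHS]/(x w - y w) xN // yN // subrr.
Qed.

Definition preserves_null (a : endo F) : Prop := forall v, fock_null v -> fock_null (a v).
Definition into_null (a : endo F) : Prop := forall v, fock_null (a v).

Let focklact_null r (v : seq P -> M) :
  (forall w qs, ideal_set J (v w qs).1 /\ (v w qs).2 = 0) ->
  forall w qs, ideal_set J (focklact r v w qs).1 /\ (focklact r v w qs).2 = 0.
Proof.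
move=> vJ [|p w] qs; last exact: vJ.
split=> //=.
have [v1 v2] := vJ [::] qs; rewrite v2 mulr0z addr0.
exact: idealMl.
Qed.

Let focklact_supp r (v : seq P -> M) N :
  (forall w, N <= size w -> v w = 0) -> (forall w, N <= size w -> focklact r v w = 0).
Proof.
move=> vN [|p w] Nw /=; last by rewrite vN.
by rewrite vN // [LHS]lact0r.
Qed.

Lemma fock_preserves_null (a : toeplitz X) (eta : {rngmorphism toeplitz X -> fock_rep X M}) :
  intertwines eta -> preserves_null (eta a).
Proof.
case=> eR eQ eP; apply: (@covrep_ind R X (toeplitz X) [set a | preserves_null (eta a)]).
- exact: toeplitz_surjective.
- have [K0 KB] := fock_null_subgroup.
  split=> [|x y xK yK v Kv]; last first.
    by rewrite /= gmulfM; apply: xK; exact: yK.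
  split=> [|x y xK yK] v Kv /=; first by rewrite raddf0.
  rewrite raddfB; apply: (KB ((eta x : endo F) v) ((eta y : endo F) v)).
    exact: xK.
    exact: yK.
- move=> r v [vJ [N vN]]; rewrite [eta _]eR; split; first exact: focklact_null.
  by exists N; exact: focklact_supp.
- move=> q v [vJ [N vN]]; rewrite [eta _]eQ; split.
    case=> [|p w] qs; first by split=> //; exact: ideal0.
    by rewrite /= /fockcrea; exact: focklact_null.
  by exists N.+1 => -[|p w] // Nw; exact: (@focklact_supp (psi X (p \ox q)) _ _ vN w Nw).
- move=> p v [vJ [N vN]]; rewrite [eta _]eP; split; first by move=> w; exact: vJ.
  by exists N => w Nw; exact: (vN (p :: w) (leqW Nw)).
Qed.

Lemma intertwines_sub_piTS (eta : {rngmorphism toeplitz X -> fock_rep X M}) r f :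
  intertwines eta -> eta (repR (toeplitz X) r - piTS fs (toeplitz X) f) =
    repR (fock_rep X M) r - piTS fs (fock_rep X M) f.
Proof.
move=> etaI; rewrite raddfB; congr (_ - _); first by case: etaI => eR _ _; exact: eR.
exact: (@piTS_intertwines R X fs (toeplitz X) (fock_rep X M) eta f etaI).
Qed.

Lemma piTS_fock_nil f (v : F) : (piTS fs (fock_rep X M) f : endo F) v [::] = 0.
Proof.
apply: (@calF_thetas _ _ [set f | (piTS fs (fock_rep X M) f : endo F) v [::] = 0]).
  split=> [|g h g0 h0] /=; first by rewrite raddf0.
  by rewrite raddfB fock_repB g0 h0 subrr.
by move=> q p /=; rewrite piTS_theta.
Qed.

(** A generator d = iota(x) - pi(Delta x) satisfies S(p) d = 0, so its values live on the empty word
    only. There pi(Delta x) contributes nothing, each of its terms starting with a creation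
    operator, and what remains is x acting on a vector of the unitization, with result in J. *)
Lemma calT_into_null (eta : {rngmorphism toeplitz X -> fock_rep X M}) a :
  intertwines eta -> ideal_set (calT fs J) a -> into_null (eta a).
Proof.
move=> etaI; move: a; suff : calT fs J `<=` [set a | into_null (eta a)] by [].
have [K0 KB] := fock_null_subgroup.
apply: ideal_genP => [|_ [x [f [Jx fE ->]]] v].
  split=> [|a b aK].
    split=> [|x y xK yK] v /=; first by rewrite raddf0.
    rewrite raddfB; apply: (KB ((eta x : endo F) v) ((eta y : endo F) v)).
    exact: xK.
    exact: yK.
  (* Right multiples only restrict the arguments; left multiples are covered because the operators
     coming from the Toeplitz ring preserve null vectors. *)
  split=> v; rewrite gmulfM; last exact: aK.
  exact: fock_preserves_null.
rewrite intertwines_sub_piTS //; set d := _ - _.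
have dE p w : d v (p :: w) = 0.
  apply: fock_rep_ann0.
  by rewrite rngMBr (repP_piTS_Delta _ _ _ fE) -repP_ract subrr.
split; last by exists 1 => -[|p w].
case=> [|p w] qs; last by rewrite dE; split=> //; exact: ideal0.
rewrite fock_repB piTS_fock_nil subr0; split=> //=.
rewrite -[X in _ + X]opprK; apply: idealB; first exact: idealMr.
by rewrite -mulrNz; exact: idealMz.
Qed.

Lemma calO_repR_inj r : faithful X J -> repR (calO fs J) r = 0 -> r = 0.
Proof.
move=> Jf r0; have [eta [etaI _]] := toeplitz_universal (fock_rep X M).
have Tr : ideal_set (calT fs J) (repR (toeplitz X) r) by apply/rproj_eq0.
have [eR _ _] := etaI.
have := calT_into_null etaI Tr; rewrite [eta _]eR => /(_ (vacuum X)).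
case=> vJ [N vN].
apply: (pairing_faithful fs Jf (N := N)) => [ps qs|ps qs Nps].
  by have [] := vJ ps qs; rewrite -[X in X ps qs]/(fockR X M r (vacuum X) : _ -> _) fockR_vacuum.
have := vN ps Nps; rewrite -[X in X ps]/(fockR X M r (vacuum X) : _ -> _) fockR_vacuum.
by move/(congr1 (@^~ qs)).
Qed.

(** If iota(r) and pi(f) agree modulo [calT], their difference sends the vacuum to a null vector.
    Its value at the empty words is r, as pi(f) contributes 0 there, so r is in J. *)
Lemma calO_QP_sub r : zspan (QPset (calO fs J)) (repR (calO fs J) r) -> ideal_set J r.
Proof.
rewrite -(range_piTS fs) => -[f _ fr].
have [eta [etaI _]] := toeplitz_universal (fock_rep X M).
have Td : ideal_set (calT fs J) (repR (toeplitz X) r - piTS fs (toeplitz X) f).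
  apply/rprojP; apply: etrans (esym fr) _; apply: esym.
  exact: (@piTS_intertwines R X fs (toeplitz X) (calO fs J) _ f (rproj_intertwines fs J)).
have := calT_into_null etaI Td; rewrite intertwines_sub_piTS // => /(_ (vacuum X)).
case=> /(_ [::] [::]) + _.
set d := (X in (X [::] [::]).1); have -> : d [::] [::] = (r, 0); last by case.
rewrite /d fock_repB piTS_fock_nil subr0.
by rewrite -[LHS]/((fockR X M r (vacuum X) : _ -> _) [::] [::]) fockR_vacuum.
Qed.
End CuntzPimsnerFock.

(** * Gradings *)

Section Decompositions.
Variable B : rngType.
Implicit Types (c : int -> B) (s : seq int) (G : int -> set B).

Lemma fsum_seq c s : uniq s -> (forall n, n \notin s -> c n = 0) ->
  \sum_(n \in setT) c n = \sum_(n <- s) c n.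
Proof.
move=> us c0; rewrite (@fsbigE _ _ _ _ setT s) //; last by move=> n _; exact: c0.
by apply: eq_bigl => n; rewrite in_setT.
Qed.

Lemma finite_support_seq c : finite_set [set n | c n != 0] ->
  exists s, uniq s /\ forall n, n \notin s -> c n = 0.
Proof.
move=> /finite_seqP[s sE]; exists (undup s); split=> [|n]; first exact: undup_uniq.
rewrite mem_undup => ns; apply/eqP/negPn/negP => cn.
have : [set n | c n != 0] n by [].
by rewrite sE /= (negbTE ns).
Qed.

Lemma zspan_decomposition G b : (forall n, is_subgroup (G n)) ->
  zspan (\bigcup_n G n) b ->
  exists c, [/\ forall n, G n (c n), finite_set [set n | c n != 0] &
    b = \sum_(n \in setT) c n].
Proof.
move=> sG; have G0 n : G n 0 by case: (sG n).
move: b; suff : zspan (\bigcup_n G n) `<=` [set b | exists c,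
  [/\ forall n, G n (c n), finite_set [set n | c n != 0] &
    b = \sum_(n \in setT) c n]] by [].
apply: zspan_sub => [|b [n _ Gb]]; last first.
  exists (fun m => if m == n then b else 0).
  have supp m : m \notin [:: n] -> (if m == n then b else 0) = 0.
    by rewrite inE => /negbTE ->.
  split=> [m||]; first by case: eqP => [->|].
    (* The support is empty, not the singleton of n, when b = 0. *)
    by apply/finite_seqP; exists (if b == 0 then [::] else [:: n]);
      apply/seteqP; split=> m /=; case: (m =P n) => [->|/eqP mn];
      case: (b =P 0) => [b0|/eqP b0]; rewrite ?b0 ?eqxx ?inE ?(negbTE mn) ?(negbTE b0) ?eqxx.
  by rewrite (@fsum_seq _ [:: n]) // big_seq1 eqxx.
split=> [|x y [c [Gc fc ->]] [d [Gd fd ->]]].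
  exists (fun=> 0); split=> //; last by rewrite fsbig1.
  by apply: (sub_finite_set _ (finite_set0 int)) => n /=; rewrite eqxx.
exists (fun n => c n - d n); split=> [n||].
- by have [_] := sG n; apply.
- apply: (@sub_finite_set _ _ ([set n | c n != 0] `|` [set n | d n != 0])).
    move=> n /= cd; apply/orP; apply: contraNT cd; rewrite negb_or !negbK.
    by move=> /andP[/eqP-> /eqP->]; rewrite subrr.
  by rewrite finite_setU.
have [s [us sc]] := finite_support_seq fc; have [t [ut td]] := finite_support_seq fd.
rewrite !(@fsum_seq _ (undup (s ++ t))) ?undup_uniq //.
- by rewrite -sumrB.
- by move=> n; rewrite mem_undup mem_cat negb_or => /andP[/sc -> /td ->]; rewrite subrr.
- by move=> n; rewrite mem_undup mem_cat negb_or => /andP[_ /td ->].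
- by move=> n; rewrite mem_undup mem_cat negb_or => /andP[/sc -> _].
Qed.

Lemma zspan_subring (A : set B) : (forall x y, A x -> A y -> A (x * y)) ->
  is_subring (zspan A).
Proof.
move=> AM; split=> [|x y Ax Ay]; first exact: zspan_subgroup.
move: x Ax; suff : zspan A `<=` [set x | zspan A (x * y)] by [].
apply: zspan_sub => [|x Ax].
  split=> [|x z xA zA] /=; first by rewrite rng0M; exact: zspan0.
  by rewrite rngMBl; exact: zspanB.
move: y Ay; suff : zspan A `<=` [set y | zspan A (x * y)] by [].
apply: zspan_sub => [|y Ay]; last by apply: zspan_mem; exact: AM.
split=> [|y z yA zA] /=; first by rewrite rngM0; exact: zspan0.
by rewrite rngMBr; exact: zspanB.
Qed.

End Decompositions.

(** * Shift operators as Laurent monomials *)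

Section Shift.
Variable B : rngType.
Local Notation V := (int -> unitz B).

(** The monomial b t^n of the Laurent polynomials over B, acting on functions of an integer. Values
    in the unitization make the operator determine b. *)
Definition shift_fun (n : int) (b : B) (v : V) : V := fun m => b *> v (m - n).

Lemma shift_funB n b : zmod_morphism (shift_fun n b).
Proof. by move=> v w; apply/funeqP => m; exact: lactBr. Qed.

Definition shift n b : endo V := mkendo (shift_funB n b).

Lemma shiftB n : zmod_morphism (shift n).
Proof. by move=> a b; apply: endoP => v; apply/funeqP => m; exact: lactBl. Qed.

Lemma shiftM m n a b : shift m a * shift n b = shift (m + n) (a * b).
Proof.
apply: endoP => v; apply/funeqP => k.
rewrite -[LHS]/(a *> (b *> v (k - m - n))) -[RHS]/((a * b) *> v (k - (m + n))).
by rewrite lactM opprD addrA.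
Qed.

HB.instance Definition _ n := GRing.isZmodMorphism.Build B (endo V) (shift n) (shiftB n).

Lemma shift0M : {morph shift 0 : a b / a * b}.
Proof. by move=> a b; rewrite shiftM addr0. Qed.
HB.instance Definition _ := monoid.isMultiplicative.Build B (endo V) (shift 0) shift0M.

(** The coefficient of t^n: the operator is evaluated at the function equal to 1 at the integer 0
    and to 0 elsewhere. *)
Definition coef (n : int) (f : endo V) : B := (f (fun m => (0, (m == 0)%:Z)) n).1.

Lemma coefB n : zmod_morphism (coef n).
Proof. by []. Qed.
HB.instance Definition _ n := GRing.isZmodMorphism.Build (endo V) B (coef n) (coefB n).

Lemma coef_shift n b m : coef m (shift n b) = if m == n then b else 0.
Proof.
rewrite /coef /= rngM0 add0r subr_eq0.
by case: eqP => _; rewrite ?mulr1z ?mulr0z.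
Qed.

End Shift.

Section Grading.
Variables (R : rngType) (X : rsystem R) (Z : covrep X).

Definition shiftR : R -> endo (int -> unitz Z) := shift 0 \o repR Z.
Definition shiftP : sysP X -> endo (int -> unitz Z) := shift (- 1) \o repP Z.
Definition shiftQ : sysQ X -> endo (int -> unitz Z) := shift 1 \o repQ Z.
HB.instance Definition _ := GRing.Additive.on shiftP.
HB.instance Definition _ := GRing.Additive.on shiftQ.
HB.instance Definition _ := RngMorphism.on shiftR.

Let shiftP_ract p r : shiftP (p <* r) = shiftP p * shiftR r.
Proof. by rewrite /shiftP /shiftR /= shiftM addr0 repP_ract. Qed.
Let shiftP_lact r p : shiftP (r *> p) = shiftR r * shiftP p.
Proof. by rewrite /shiftP /shiftR /= shiftM add0r repP_lact. Qed.
Let shiftQ_ract q r : shiftQ (q <* r) = shiftQ q * shiftR r.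
Proof. by rewrite /shiftQ /shiftR /= shiftM addr0 repQ_ract. Qed.
Let shiftQ_lact r q : shiftQ (r *> q) = shiftR r * shiftQ q.
Proof. by rewrite /shiftQ /shiftR /= shiftM add0r repQ_lact. Qed.
Let shift_psi p q : shiftR (psi X (p \ox q)) = shiftP p * shiftQ q.
Proof. by rewrite /shiftP /shiftQ /shiftR /= shiftM addNr rep_psi. Qed.

Definition shift_rep : covrep X := @CovRep R X (endo (int -> unitz Z))
  shiftP shiftQ shiftR shiftP_ract shiftP_lact shiftQ_ract shiftQ_lact shift_psi.

Lemma shift_QPset z : zspan (QPset Z) z -> zspan (QPset shift_rep) (shift 0 z).
Proof.
move: z; suff : zspan (QPset Z) `<=` [set z | zspan (QPset shift_rep) (shift 0 z)] by [].
apply: zspan_sub => [|_ [q [p ->]]].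
  split=> [|x y Zx Zy] /=; first by rewrite raddf0; exact: zspan0.
  by rewrite raddfB; exact: zspanB.
apply: zspan_mem; exists q, p.
by rewrite -[RHS]/(shift 1 (repQ Z q) * shift (-1) (repP Z p)) shiftM subrr.
Qed.

(** Decompositions exist because the span of the G n is a subring containing the generators. They
    are unique because the component of degree n must be the coefficient of t^n in [delta b]. *)
Lemma shift_graded (delta : {rngmorphism Z -> shift_rep}) :
  surjective_rep Z -> intertwines delta -> graded_rep Z.
Proof.
move=> sZ [dR dQ dP]; pose G n : set Z := [set b | delta b = shift n b].
have sG n : is_subgroup (G n).
  by split=> [|x y Gx Gy]; rewrite /G /= ?raddf0 // !raddfB /= Gx Gy.
have GM m n x y : G m x -> G n y -> G (m + n) (x * y).
  by move=> Gx Gy; rewrite /G /= gmulfM /= Gx Gy shiftM.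
have [GR GQ GP] : [/\ range (repR Z) `<=` G 0, range (repQ Z) `<=` G 1
    & range (repP Z) `<=` G (- 1)].
  by split=> _ [x _ <-]; [exact: dR|exact: dQ|exact: dP].
exists G; split=> //; split=> // b.
have [c [Gc fc bE]] : exists c, [/\ forall n, G n (c n), finite_set [set n | c n != 0] &
    b = \sum_(n \in setT) c n].
  apply: zspan_decomposition => //; move: b; apply: (covrep_ind sZ).
  - apply: zspan_subring => x y [m _ Gx] [n _ Gy].
    by exists (m + n) => //; exact: GM.
  - by move=> r; apply: zspan_mem; exists 0 => //; apply: GR; exists r.
  - by move=> r; apply: zspan_mem; exists 1 => //; apply: GQ; exists r.
  - by move=> r; apply: zspan_mem; exists (- 1) => //; apply: GP; exists r.
have coefE d : (forall n, G n (d n)) -> finite_set [set n | d n != 0] ->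
    b = \sum_(n \in setT) d n -> forall n, d n = coef n (delta b).
  move=> Gd fd -> n; have [s [us s0]] := finite_support_seq fd.
  rewrite (fsum_seq us s0) !raddf_sum /= .
  rewrite (eq_bigr (fun m => if n == m then d m else 0)); last first.
    by move=> m _; rewrite (Gd m) coef_shift.
  have [ns|ns] := boolP (n \in s).
    rewrite (bigD1_seq n) //= eqxx big1 ?addr0 // => i.
    by rewrite eq_sym => /negbTE ->.
  rewrite s0 // big_seq big1 // => i si.
  by case: eqP => [ni|//]; rewrite ni si in ns.
exists c; split=> // d [Gd fd bE']; apply/funeqP => n.
by rewrite (coefE c) // (coefE d).
Qed.

End Grading.

(** * Graded uniqueness *)

Section Homogeneous.
Variables (R : rngType) (X : rsystem R) (Y : covrep X).
Local Notation P := (sysP X).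
Local Notation Q := (sysQ X).
Local Notation sigma := (repR Y).

Lemma zspan_lmul (A C : set Y) z : is_subgroup C -> (forall x, A x -> C (z * x)) ->
  forall x, zspan A x -> C (z * x).
Proof.
move=> [C0 CB] sAC; suff : zspan A `<=` [set x | C (z * x)] by [].
apply: zspan_sub => //; split=> [|x y xC yC] /=; first by rewrite rngM0.
by rewrite rngMBr; exact: CB.
Qed.

Lemma zspan_rmul (A C : set Y) z : is_subgroup C -> (forall x, A x -> C (x * z)) ->
  forall x, zspan A x -> C (x * z).
Proof.
move=> [C0 CB] sAC; suff : zspan A `<=` [set x | C (x * z)] by [].
apply: zspan_sub => //; split=> [|x y xC yC] /=; first by rewrite rng0M.
by rewrite rngMBl; exact: CB.
Qed.

Lemma zspan_mono (A C : set Y) : A `<=` C -> zspan A `<=` zspan C.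
Proof. by move=> sAC; apply: zspan_sub; [exact: zspan_subgroup|move=> x /sAC; exact: zspan_mem]. Qed.

Definition sandwich (A : set Y) : set Y :=
  [set y | exists q x p, A x /\ y = repQ Y q * x * repP Y p].
Definition lTspan (A : set Y) : set Y := zspan [set y | exists q x, A x /\ y = repQ Y q * x].
Definition rSspan (A : set Y) : set Y := zspan [set y | exists x p, A x /\ y = x * repP Y p].

(* The elements sigma(r) + (sum of T(q1)...T(qn) sigma(r') S(p1)...S(pn) with     *)
(* 1 <= n <= N).                                                                 *)
Fixpoint level N : set Y :=
  if N is N'.+1 then
    [set y | exists r w, zspan (sandwich (level N')) w /\ y = sigma r + w]
  else range sigma.

Definition deg0 : set Y := \bigcup_N level N.

(** One-sided normal forms: k factors T(q) to the left of an element of degree 0, or, in [degN], k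
    factors S(p) to its right. An outer factor can then be cancelled by multiplying with S(p) on the
    left or T(q) on the right. *)
Definition degP k : set Y := iter k lTspan deg0.
Definition degN k : set Y := iter k rSspan deg0.
Definition deg (n : int) : set Y :=
  match n with Posz k => degP k | Negz k => degN k.+1 end.

Lemma level_sigma N r : level N (sigma r).
Proof.
by case: N => [|N]; [exists r|exists r, 0; split; [exact: zspan0|rewrite addr0]].
Qed.

Lemma level_sandwich N y : zspan (sandwich (level N)) y -> level N.+1 y.
Proof. by move=> Ny; exists 0, y; rewrite raddf0 add0r. Qed.

Lemma level_subgroup N : is_subgroup (level N).
Proof.
case: N => [|N]; split.
- by exists 0; rewrite ?raddf0.
- by move=> _ _ [r _ <-] [s _ <-]; exists (r - s); rewrite ?raddfB.
- by exists 0, 0; split; [exact: zspan0|rewrite raddf0 addr0].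
move=> _ _ [r [w [Nw ->]]] [s [w' [Nw' ->]]]; exists (r - s), (w - w').
by split; [exact: zspanB|rewrite raddfB opprD addrACA].
Qed.

Lemma sandwich_mono (A C : set Y) : A `<=` C -> sandwich A `<=` sandwich C.
Proof. by move=> sAC _ [q [x [p [Ax ->]]]]; exists q, x, p; split=> //; exact: sAC. Qed.

Lemma levelS N : level N `<=` level N.+1.
Proof.
elim: N => [|N IH]; first by move=> _ [r _ <-]; exact: level_sigma.
move=> _ [r [w [Nw ->]]]; exists r, w; split=> //.
by apply: (zspan_mono _ Nw); exact: sandwich_mono.
Qed.

Lemma level_le m n : m <= n -> level m `<=` level n.
Proof.
move=> mn; rewrite -(subnKC mn); elim: (n - m)%N => [|k IH]; first by rewrite addn0.
by rewrite addnS => x /IH; exact: levelS.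
Qed.

Lemma deg0_subgroup : is_subgroup deg0.
Proof.
split=> [|x y [m _ mx] [n _ ny]]; first by exists 0 => //; exact: (level_subgroup 0).1.
exists (maxn m n) => //; apply: (level_subgroup _).2.
  by apply: (level_le _ mx); exact: leq_maxl.
by apply: (level_le _ ny); exact: leq_maxr.
Qed.

Lemma degP_subgroup k : is_subgroup (degP k).
Proof. by case: k => [|k]; [exact: deg0_subgroup|exact: zspan_subgroup]. Qed.
Lemma degN_subgroup k : is_subgroup (degN k).
Proof. by case: k => [|k]; [exact: deg0_subgroup|exact: zspan_subgroup]. Qed.
Lemma deg_subgroup n : is_subgroup (deg n).
Proof. by case: n => k; [exact: degP_subgroup|exact: (degN_subgroup k.+1)]. Qed.

Lemma level_lmul N r y : level N y -> level N (sigma r * y).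
Proof.
case: N => [[s _ <-]|N [s [w [Nw ->]]]]; first by exists (r * s); rewrite ?gmulfM.
exists (r * s), (sigma r * w); split; last by rewrite rngMDr gmulfM.
apply: (zspan_lmul _ _ Nw) => [|_ [q [x [p [Nx ->]]]]]; first exact: zspan_subgroup.
by rewrite !mulgA -repQ_lact; apply: zspan_mem; exists (r *> q), x, p.
Qed.

Lemma level_rmul N r y : level N y -> level N (y * sigma r).
Proof.
case: N => [[s _ <-]|N [s [w [Nw ->]]]]; first by exists (s * r); rewrite ?gmulfM.
exists (s * r), (w * sigma r); split; last by rewrite rngMDl gmulfM.
apply: (zspan_rmul _ _ Nw) => [|_ [q [x [p [Nx ->]]]]]; first exact: zspan_subgroup.
by rewrite -!mulgA -repP_ract; apply: zspan_mem; exists q, x, (p <* r); rewrite mulgA.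
Qed.

Lemma degP_lmul k r y : degP k y -> degP k (sigma r * y).
Proof.
case: k => [[N _ Ny]|k /= ky]; first by exists N => //; exact: level_lmul.
apply: (zspan_lmul _ _ ky) => [|_ [q [x [kx ->]]]]; first exact: zspan_subgroup.
by rewrite mulgA -repQ_lact; apply: zspan_mem; exists (r *> q), x.
Qed.

Lemma degN_rmul k r y : degN k y -> degN k (y * sigma r).
Proof.
case: k => [[N _ Ny]|k /= ky]; first by exists N => //; exact: level_rmul.
apply: (zspan_rmul _ _ ky) => [|_ [x [p [kx ->]]]]; first exact: zspan_subgroup.
by rewrite -mulgA -repP_ract; apply: zspan_mem; exists x, (p <* r).
Qed.

Lemma degN_lmul k r y : degN k y -> degN k (sigma r * y).
Proof.
elim: k y => [y [N _ Ny]|k IH y /= ky]; first by exists N => //; exact: level_lmul.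
apply: (zspan_lmul _ _ ky) => [|_ [x [p [kx ->]]]]; first exact: zspan_subgroup.
by rewrite mulgA; apply: zspan_mem; exists (sigma r * x), p; split=> //; exact: IH.
Qed.

Section FS.
Hypothesis fs : condFS X.

Lemma zspan_QPset_mul : is_subring (zspan (QPset Y)).
Proof.
apply: zspan_subring => _ _ [q [p ->]] [q' [p' ->]].
by exists (q <* psi X (p \ox q')), p'; rewrite repQ_ract rep_psi !mulgA.
Qed.

(** A member of the span involves finitely many leading factors T(q), and (FS) gives one e fixing
    all of them. *)
Lemma span_left_unit (A : set Y) w : (forall y, A y -> exists q x, y = repQ Y q * x) ->
  zspan A w -> exists2 e, zspan (QPset Y) e & e * w = w.
Proof.
move=> AT Aw; have [qs qsP] : exists qs : seq Q, forall e,
    {in qs, forall q, e * repQ Y q = repQ Y q} -> e * w = w.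
  move: w Aw; suff : zspan A `<=` [set w | exists qs : seq Q, forall e,
    {in qs, forall q, e * repQ Y q = repQ Y q} -> e * w = w] by [].
  apply: zspan_sub => [|_ /AT[q [x ->]]]; last first.
    by exists [:: q] => e eP; rewrite mulgA eP ?mem_head.
  split=> [|x y [s sP] [t tP]]; first by exists [::] => e _; rewrite rngM0.
  exists (s ++ t) => e eP; rewrite rngMBr sP ?tP // => p ps; apply: eP.
    by rewrite mem_cat ps orbT.
  by rewrite mem_cat ps.
by have [e Fe eP] := QP_left_unit fs Y qs; exists e => //; exact: qsP.
Qed.

Lemma span_right_unit (A : set Y) w : (forall y, A y -> exists x p, y = x * repP Y p) ->
  zspan A w -> exists2 e, zspan (QPset Y) e & w * e = w.
Proof.
move=> AT Aw; have [ps psP] : exists ps : seq P, forall e,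
    {in ps, forall p, repP Y p * e = repP Y p} -> w * e = w.
  move: w Aw; suff : zspan A `<=` [set w | exists ps : seq P, forall e,
    {in ps, forall p, repP Y p * e = repP Y p} -> w * e = w] by [].
  apply: zspan_sub => [|_ /AT[x [p ->]]]; last first.
    by exists [:: p] => e eP; rewrite -mulgA eP ?mem_head.
  split=> [|x y [s sP] [t tP]]; first by exists [::] => e _; rewrite rng0M.
  exists (s ++ t) => e eP; rewrite rngMBl sP ?tP // => p ps; apply: eP.
    by rewrite mem_cat ps orbT.
  by rewrite mem_cat ps.
by have [e Fe eP] := QP_right_unit fs Y ps; exists e => //; exact: psP.
Qed.

(** R may have no unit to write q as q1; instead (FS) writes q as a sum of elements q' psi(p ⊗ q),
    up to sign. *)
Lemma repQ_lTspan q (C : set Y) : (forall r, C (sigma r)) -> lTspan C (repQ Y q).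
Proof.
move=> Cs; have [T' [_ [FT _ Tq _]]] := fs [:: q] [::].
rewrite -(Tq q (mem_head _ _)).
suff : @calFPQ R X `<=` [set f | lTspan C (repQ Y (f q))] by apply.
apply: zspan_sub => [|_ [q' [p ->]]].
  split=> [|f g fC gC] /=; first by rewrite raddf0; exact: zspan0.
  by rewrite -[(f - g) q]/(f q - g q) raddfB; exact: zspanB.
rewrite /= repQ_ract; apply: zspan_mem.
by exists q', (sigma (psi X (p \ox q))).
Qed.

Lemma repP_rSspan p (C : set Y) : (forall r, C (sigma r)) -> rSspan C (repP Y p).
Proof.
move=> Cs; have [_ [T' [_ FT _ Tp]]] := fs [::] [:: p].
rewrite -(Tp p (mem_head _ _)).
suff : @calFQP R X `<=` [set f | rSspan C (repP Y (f p))] by apply.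
apply: zspan_sub => [|_ [p' [q ->]]].
  split=> [|f g fC gC] /=; first by rewrite raddf0; exact: zspan0.
  by rewrite -[(f - g) p]/(f p - g p) raddfB; exact: zspanB.
rewrite /= repP_lact; apply: zspan_mem.
by exists (sigma (psi X (p \ox q))), p'.
Qed.

Local Notation total := (zspan (\bigcup_n deg n)).

Lemma total_degP k x : degP k x -> total x.
Proof. by move=> kx; apply: zspan_mem; exists (Posz k). Qed.
Lemma total_degN k x : degN k x -> total x.
Proof. by case: k => [|k] kx; apply: zspan_mem; [exists 0|exists (Negz k)]. Qed.

Lemma total_lsigma r x : total x -> total (sigma r * x).
Proof.
apply: zspan_lmul => [|y [[k|k] _ ky]]; first exact: zspan_subgroup.
  by apply: (@total_degP k); exact: degP_lmul.
by apply: (@total_degN k.+1); exact: degN_lmul.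
Qed.

Lemma degN_lT k q x : degN k.+1 x -> degN k (repQ Y q * x).
Proof.
elim: k x => [|k IH] x; apply: zspan_lmul; try exact: degN_subgroup.
  move=> _ [y [p [[N _ Ny] ->]]]; exists N.+1 => //; apply: level_sandwich.
  by apply: zspan_mem; exists q, y, p; rewrite mulgA.
move=> _ [y [p [ky ->]]]; rewrite mulgA; apply: zspan_mem.
by exists (repQ Y q * y), p; split=> //; exact: IH.
Qed.

Lemma total_lT q x : total x -> total (repQ Y q * x).
Proof.
apply: zspan_lmul => [|y [[k|k] _ ky]]; first exact: zspan_subgroup.
  by apply: (@total_degP k.+1); apply: zspan_mem; exists q, y.
by apply: (@total_degN k); exact: degN_lT.
Qed.

Lemma degP_lS k p x : degP k.+1 x -> degP k (repP Y p * x).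
Proof.
apply: zspan_lmul => [|_ [q [y [ky ->]]]]; first exact: degP_subgroup.
by rewrite mulgA -rep_psi; exact: degP_lmul.
Qed.

Lemma degN_rT k q x : degN k.+1 x -> degN k (x * repQ Y q).
Proof.
apply: zspan_rmul => [|_ [y [p [ky ->]]]]; first exact: degN_subgroup.
by rewrite -mulgA -rep_psi; exact: degN_rmul.
Qed.

(** In degree 0, S(p) meets either sigma(r), giving S(pr), which (FS) rewrites with a scalar on the
    left, or a leading T(q), giving the scalar sigma(psi(p ⊗ q)). *)
Lemma degN_lS k p x : degN k x -> degN k.+1 (repP Y p * x).
Proof.
elim: k x => [x [[|N] _ Nx]|k IH x].
- case: Nx => r _ <-; rewrite -repP_ract; apply: repP_rSspan => s.
  by exists 0 => //; exists s.
- case: Nx => r [w [Nw ->]]; rewrite rngMDr; apply: zspanD.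
    rewrite -repP_ract; apply: repP_rSspan => s.
    by exists 0 => //; exists s.
  apply: (zspan_lmul _ _ Nw) => [|_ [q [y [p' [Ny ->]]]]]; first exact: zspan_subgroup.
  rewrite !mulgA -rep_psi; apply: zspan_mem; exists (sigma (psi X (p \ox q)) * y), p'.
  by split=> //; exists N => //; exact: level_lmul.
apply: zspan_lmul => [|_ [y [p' [ky ->]]]]; first exact: zspan_subgroup.
rewrite mulgA; apply: zspan_mem; exists (repP Y p * y), p'; split=> //; exact: IH.
Qed.

Lemma total_lS p x : total x -> total (repP Y p * x).
Proof.
apply: zspan_lmul => [|y [[[|k]|k] _ ky]]; first exact: zspan_subgroup.
- by apply: (@total_degN 1); exact: degN_lS.
- by apply: (@total_degP k); exact: degP_lS.
by apply: (@total_degN k.+2); exact: degN_lS.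
Qed.

(** The elements of [total] whose left multiplication preserves [total] form a subring, so only left
    multiplication by the three kinds of generators has to be examined. *)
Lemma totalT : surjective_rep Y -> forall y, total y.
Proof.
move=> sY y.
have [] : [set y | total y /\ forall x, total x -> total (y * x)] y; last by [].
move: y; apply: (covrep_ind sY).
- split=> [|x y [xt xl] [yt yl]].
    split=> [|x y [xt xl] [yt yl]].
      by split=> [|x _]; [exact: zspan0|rewrite rng0M; exact: zspan0].
    split=> [|z zt]; first exact: zspanB.
    by rewrite rngMBl; apply: zspanB; [exact: xl|exact: yl].
  split=> [|z zt]; first exact: xl.
  by rewrite -mulgA; apply: xl; exact: yl.
- move=> r; split=> [|x]; last exact: total_lsigma.
  by apply: (@total_degP 0); exists 0 => //; exists r.
- move=> q; split=> [|x]; last exact: total_lT.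
  by apply: (@total_degP 1); apply: repQ_lTspan => r; exists 0 => //; exists r.
- move=> p; split=> [|x]; last exact: total_lS.
  by apply: (@total_degN 1); apply: repP_rSspan => r; exists 0 => //; exists r.
Qed.

End FS.
End Homogeneous.
Arguments level {R X} Y N.
Arguments degP {R X} Y k.
Arguments degN {R X} Y k.
Arguments deg {R X} Y n.

(** * Injectivity on homogeneous elements and on the whole ring *)

Section GradedUniqueness.
Variables (R : rngType) (X : rsystem R) (fs : condFS X) (Y Z : covrep X).
Variable f : {rngmorphism Y -> Z}.
(** In the application, [Zinj] and [ZY] are the inclusions of the ideals of the target
    representation in I and J, read over R/I. *)
Hypotheses (fI : intertwines f) (Zinj : forall r, repR Z r = 0 -> r = 0).
Hypothesis ZY : forall r, zspan (QPset Z) (repR Z r) -> zspan (QPset Y) (repR Y r).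

Let fR r : f (repR Y r) = repR Z r. Proof. by case: fI => + _ _; apply. Qed.
Let fQ q : f (repQ Y q) = repQ Z q. Proof. by case: fI => _ + _; apply. Qed.
Let fP p : f (repP Y p) = repP Z p. Proof. by case: fI => _ _; apply. Qed.

(** If pi(g) = 0 in Z, then sigma(psi(p ⊗ g(q))) = S(p) pi(g) T(q) = 0 for all p and q; injectivity
    of sigma and nondegeneracy of psi give g = 0. *)
Lemma QP_ker0 y : zspan (QPset Y) y -> f y = 0 -> y = 0.
Proof.
rewrite -(range_piTS fs) => -[g _ <-]; rewrite piTS_intertwines // => g0.
rewrite (_ : g = 0) ?raddf0 //; apply: calF_inj => q.
apply: (Q_eq0 fs) => p; apply: Zinj.
by rewrite rep_psi -(piTS_repQ fs) g0 rng0M rngM0.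
Qed.

(** Induction on N: S(p) y T(q) lies one level lower and in the kernel, so it vanishes. Local units
    from (FS) then force y into the span of the T(q)S(p), where [QP_ker0] applies. *)
Lemma level_ker0 N y : level Y N y -> f y = 0 -> y = 0.
Proof.
elim: N y => [y [r _ <-]|N IH y [r [w [Nw yE]]] fy0].
  by rewrite fR => /Zinj ->; rewrite raddf0.
have [L0 LB] := level_subgroup Y N.
have LD a b : level Y N a -> level Y N b -> level Y N (a + b).
  by move=> Na Nb; rewrite -[b]opprK -[- b]sub0r; apply: (LB) => //; exact: LB.
have SyT p q : repP Y p * y * repQ Y q = 0.
  apply: IH; last by rewrite !gmulfM /= fy0 rngM0 rng0M.
  rewrite yE rngMDr rngMDl -repP_ract -rep_psi; apply: LD; first exact: level_sigma.
  (* In a sandwich, S(p) and T(q) absorb the outer T(q') and S(p') into scalars, and the inner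
     element of level N remains. *)
  move: w Nw {yE}; suff : zspan (sandwich (level Y N)) `<=`
    [set w | level Y N (repP Y p * w * repQ Y q)] by [].
  apply: zspan_sub => [|_ [q' [x [p' [Nx ->]]]]].
    by split=> [|a b Na Nb] /=; rewrite ?rngM0 ?rng0M // rngMBr rngMBl; exact: LB.
  rewrite /= !mulgA -rep_psi -[_ * repP Y p' * _]mulgA -rep_psi.
  by apply: level_rmul; exact: level_lmul.
have yT0 e q : zspan (QPset Y) e -> e * y * repQ Y q = 0.
  move: e; suff : zspan (QPset Y) `<=` [set e | e * y * repQ Y q = 0] by [].
  apply: zspan_sub => [|_ [q' [p ->]]]; last first.
    by rewrite /= -!mulgA [repP Y p * _]mulgA SyT rngM0.
  by split=> [|a b a0 b0] /=; rewrite ?rng0M // !rngMBl a0 b0 subrr.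
have [e Fe ew] : exists2 e, zspan (QPset Y) e & e * w = w.
  apply: (span_left_unit fs _ Nw) => _ [q [x [p [_ ->]]]].
  by exists q, (x * repP Y p); rewrite mulgA.
have [e' Fe' we'] : exists2 e, zspan (QPset Y) e & w * e = w.
  apply: (span_right_unit fs _ Nw) => _ [q [x [p [_ ->]]]].
  by exists (repQ Y q * x), p.
have eye' : e * y * e' = 0.
  move: e' Fe' {we'}; suff : zspan (QPset Y) `<=` [set e' | e * y * e' = 0] by [].
  apply: zspan_sub => [|_ [q [p ->]]]; last by rewrite /= mulgA yT0 // rng0M.
  by split=> [|a b a0 b0] /=; rewrite ?rngM0 // rngMBr a0 b0 subrr.
(* As e w e' = w, the relation e y e' = 0 expresses w through e sigma(r) e', which is in the span
   since e and e' are. *)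
have Fw : zspan (QPset Y) w.
  have -> : w = - (e * repR Y r * e').
    by apply/eqP; rewrite -addr_eq0 addrC -{1}we' -{1}ew -rngMDl -rngMDr -yE eye'.
  apply: zspanN; apply: (zspan_QPset_mul Y).2 => //.
  by move: Fe; rewrite -{1}(range_piTS fs) => -[g _ <-]; exact: piTS_repR.
(* It remains to see that sigma(r) is in the span: in Z it equals -f(w), and [ZY] brings this
   membership back to Y. *)
apply: QP_ker0 => //; rewrite yE; apply: zspanD => //; apply: ZY.
have : f (repR Y r) + f w = 0 by rewrite -raddfD -yE.
rewrite fR => /eqP; rewrite addr_eq0 => /eqP ->.
by apply: zspanN; exact: QPset_intertwines.
Qed.

(** (FS) gives y = e y with e a sum of products T(q)S(p), up to sign, and each S(p) y is a kernel
    element of degree k, hence 0 by induction. *)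
Lemma degP_ker0 k y : degP Y k y -> f y = 0 -> y = 0.
Proof.
elim: k y => [y [N _ Ny]|k IH y ky fy0]; first exact: level_ker0 Ny.
have [e Fe <-] : exists2 e, zspan (QPset Y) e & e * y = y.
  by apply: (span_left_unit fs _ ky) => _ [q [x [_ ->]]]; exists q, x.
move: e Fe; suff : zspan (QPset Y) `<=` [set e | e * y = 0] by [].
apply: zspan_sub => [|_ [q [p ->]]] /=.
  by split=> [|a b a0 b0] /=; rewrite ?rng0M // rngMBl a0 b0 subrr.
rewrite -mulgA (IH (repP Y p * y)) ?rngM0 //; first exact: degP_lS.
by rewrite gmulfM /= fy0 rngM0.
Qed.

Lemma degN_ker0 k y : degN Y k y -> f y = 0 -> y = 0.
Proof.
elim: k y => [y [N _ Ny]|k IH y ky fy0]; first exact: level_ker0 Ny.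
have [e Fe <-] : exists2 e, zspan (QPset Y) e & y * e = y.
  by apply: (span_right_unit fs _ ky) => _ [x [p [_ ->]]]; exists x, p.
move: e Fe; suff : zspan (QPset Y) `<=` [set e | y * e = 0] by [].
apply: zspan_sub => [|_ [q [p ->]]] /=.
  by split=> [|a b a0 b0] /=; rewrite ?rngM0 // rngMBr a0 b0 subrr.
rewrite mulgA (IH (y * repQ Y q)) ?rng0M //; first exact: degN_rT.
by rewrite gmulfM /= fy0 rng0M.
Qed.

Lemma graded_injective : surjective_rep Y -> graded_rep Z -> injective f.
Proof.
move=> sY [G [[sG Gdec GM] GR GQ GP]].
have fspan (A : set Y) n : A `<=` [set y | G n (f y)] -> zspan A `<=` [set y | G n (f y)].
  move=> sAG; apply: zspan_sub => //; have [G0 GB] := sG n.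
  by split=> [|a b Ga Gb] /=; [rewrite raddf0|rewrite raddfB; exact: GB].
have GfR r : G 0 (f (repR Y r)) by rewrite fR; apply: GR; exists r.
have GfQ q : G 1 (f (repQ Y q)) by rewrite fQ; apply: GQ; exists q.
have GfP p : G (- 1) (f (repP Y p)) by rewrite fP; apply: GP; exists p.
have Glevel N y : level Y N y -> G 0 (f y).
  elim: N y => [_ [r _ <-] //|N IH _ [r [w [Nw ->]]]].
  have [G0 GB] := sG 0; rewrite raddfD /= -[f w]opprK; apply: (GB) => //.
  rewrite -sub0r; apply: (GB) => //; apply: (fspan (sandwich (level Y N)) 0 _ _ Nw).
  move=> _ [q [x [p [Nx ->]]]] /=; rewrite !gmulfM.
  exact: (GM (1 + 0) (- 1) _ _ (GM 1 0 _ _ (GfQ q) (IH x Nx)) (GfP p)).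
have GdegP k y : degP Y k y -> G k%:Z (f y).
  elim: k y => [y [N _ Ny]|k IH]; first exact: Glevel Ny.
  apply: fspan => _ [q [x [kx ->]]] /=; rewrite gmulfM intS.
  exact: (GM 1 k _ _ (GfQ q) (IH x kx)).
have GdegN k y : degN Y k y -> G (- k%:Z) (f y).
  elim: k y => [y [N _ Ny]|k IH]; first exact: Glevel Ny.
  apply: fspan => _ [x [p [kx ->]]] /=; rewrite gmulfM intS addrC opprD.
  exact: (GM (- k%:Z) (- 1) _ _ (IH x kx) (GfP p)).
have Gdeg n y : deg Y n y -> G n (f y).
  by case: n => k ky; [exact: GdegP|rewrite NegzE; exact: GdegN].
have deg0 n y : deg Y n y -> f y = 0 -> y = 0.
  by case: n => k ky; [exact: degP_ker0 ky|exact: degN_ker0 ky].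
have ker0 y : f y = 0 -> y = 0.
  move=> fy0; have [c [dc fc yE]] := zspan_decomposition (deg_subgroup Y) (totalT fs sY y).
  have [s [us s0]] := finite_support_seq fc.
  have fs0 n : n \notin s -> f (c n) = 0 by move=> /s0 ->; rewrite raddf0.
  (* The images f(c n) and the zero family both decompose 0 in Z; uniqueness makes each f(c n)
     vanish. *)
  have [d [_ dU]] := Gdec 0.
  have cE : d = (fun n => f (c n)).
    apply: dU; split=> [n||]; first exact: Gdeg.
      apply: (sub_finite_set _ fc) => n /=; apply: contra => /eqP ->.
      by rewrite raddf0.
    by rewrite (fsum_seq us fs0) -(raddf_sum f) -(fsum_seq us s0) -yE; exact: esym fy0.
  have d0 : d = (fun=> 0).
    apply: dU; split=> [n||]; first by case: (sG n).
      by apply: (sub_finite_set _ (finite_set0 int)) => n /=; rewrite eqxx.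
    by rewrite fsbig1.
  rewrite yE fsbig1 // => n _; apply: (deg0 n) => //.
  by rewrite -[LHS]/((fun n => f (c n)) n) -cE d0.
move=> x y xy; apply/eqP; rewrite -subr_eq0; apply/eqP/ker0.
by rewrite raddfB /= xy subrr.
Qed.

End GradedUniqueness.

(** * T-pairs *)

Section Pull.
Variables (R : rngType) (X : rsystem R) (fs : condFS X) (I : rideal R).
Variables (inv : psi_invariant X I) (Y : covrep (quot_system fs inv)).

Lemma pull_QPset : QPset (covrep_pull Y) = QPset Y :> set Y.
Proof.
apply/seteqP; split=> _ [a [b ->]]; first by exists (projQ fs inv a), (projP fs inv b).
have [q <-] := projQ_surj a; have [p <-] := projP_surj b.
by exists q, p.
Qed.

Lemma pull_surjective : surjective_rep Y -> surjective_rep (covrep_pull Y).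
Proof.
move=> sY; apply/seteqP; split=> // y _ C [sC gC].
apply: (@covrep_ind _ _ Y C sY) => // a.
- by have [r <-] := rproj_surj a; apply: gC; left; left; exists r.
- by have [r <-] := projQ_surj a; apply: gC; left; right; exists r.
- by have [r <-] := projP_surj a; apply: gC; right; exists r.
Qed.

End Pull.

(** * Representations killing I, seen over the quotient system *)

Section Descend.
Variables (R : rngType) (X : rsystem R) (fs : condFS X) (I : rideal R).
Variables (inv : psi_invariant X I) (Z : covrep X) (IZ : I `<=` I_rep Z).

Let R0 x : ideal_set I x -> repR Z x = 0. Proof. exact: IZ. Qed.
Let Q0 m : @prodQI R X I m -> repQ Z m = 0.
Proof. by move=> [q [x [Ix ->]]]; rewrite repQ_ract R0 // rngM0. Qed.
Let P0 m : @prodIP R X I m -> repP Z m = 0.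
Proof. by move=> [x [p [Ix ->]]]; rewrite repP_lact R0 // rng0M. Qed.

Definition descR : rquot I -> Z := quotlift R0.
Definition descQ : Defs.quotQ fs inv -> Z := quotlift Q0.
Definition descP : Defs.quotP fs inv -> Z := quotlift P0.

Lemma descRE r : descR (rproj I r) = repR Z r. Proof. exact: quotliftE. Qed.
Lemma descQE q : descQ (projQ fs inv q) = repQ Z q. Proof. exact: quotliftE. Qed.
Lemma descPE p : descP (projP fs inv p) = repP Z p. Proof. exact: quotliftE. Qed.

Let descR_zmod : zmod_morphism descR. Proof. by move=> a b; exact: raddfB. Qed.
Let descQ_zmod : zmod_morphism descQ. Proof. by move=> a b; exact: raddfB. Qed.
Let descP_zmod : zmod_morphism descP. Proof. by move=> a b; exact: raddfB. Qed.
Let descR_mul : {morph descR : a b / a * b}.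
Proof.
move=> a b; have [r <-] := rproj_surj a; have [s <-] := rproj_surj b.
by rewrite -gmulfM !descRE gmulfM.
Qed.
HB.instance Definition _ := GRing.isZmodMorphism.Build (rquot I) Z descR descR_zmod.
HB.instance Definition _ := GRing.isZmodMorphism.Build (Defs.quotQ fs inv) Z descQ descQ_zmod.
HB.instance Definition _ := GRing.isZmodMorphism.Build (Defs.quotP fs inv) Z descP descP_zmod.
HB.instance Definition _ := monoid.isMultiplicative.Build (rquot I) Z descR descR_mul.

Let descP_ract a r : descP (a <* r) = descP a * descR r.
Proof.
have [p <-] := projP_surj a; have [s <-] := rproj_surj r.
by rewrite -projPr !descPE descRE repP_ract.
Qed.
Let descP_lact r a : descP (r *> a) = descR r * descP a.
Proof.
have [p <-] := projP_surj a; have [s <-] := rproj_surj r.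
by rewrite -projPl !descPE descRE repP_lact.
Qed.
Let descQ_ract a r : descQ (a <* r) = descQ a * descR r.
Proof.
have [p <-] := projQ_surj a; have [s <-] := rproj_surj r.
by rewrite -projQr !descQE descRE repQ_ract.
Qed.
Let descQ_lact r a : descQ (r *> a) = descR r * descQ a.
Proof.
have [p <-] := projQ_surj a; have [s <-] := rproj_surj r.
by rewrite -projQl !descQE descRE repQ_lact.
Qed.
Let desc_psi a b : descR (psi (quot_system fs inv) (a \ox b)) = descP a * descQ b.
Proof.
have [p <-] := projP_surj a; have [q <-] := projQ_surj b.
by rewrite [psi _ _](psiIE fs inv p q) descRE descPE descQE rep_psi.
Qed.

Definition covrep_desc : covrep (quot_system fs inv) :=
  @CovRep (rquot I) (quot_system fs inv) Z descP descQ descR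
    descP_ract descP_lact descQ_ract descQ_lact desc_psi.

(** Descending and pulling back recovers the maps of Z pointwise; phrasing this as an intertwiner
    avoids an equality of records. *)
Lemma desc_pull : intertwines (idfun : covrep_pull covrep_desc -> Z).
Proof. by split=> x /=; [exact: descRE|exact: descQE|exact: descPE]. Qed.

Lemma desc_QPset : QPset covrep_desc = QPset Z :> set Z.
Proof.
rewrite -pull_QPset; apply/seteqP; split=> _ [q [p ->]]; exists q, p.
  by rewrite /= descQE descPE.
by rewrite /= descQE descPE.
Qed.

End Descend.

Lemma J_repE (R : rngType) (X : rsystem R) (fs : condFS X) (Z : covrep X) r :
  J_rep fs Z r <-> zspan (QPset Z) (repR Z r).
Proof. by rewrite -(range_piTS fs). Qed.

Section TPair.
Variables (R : rngType) (X : rsystem R) (fs : condFS X) (w : tpair fs).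
Local Notation fs' := (quot_condFS fs (tp_inv w)).
Local Notation J' := (rproj_ideal (tpI w) (tpJ w)).
Local Notation O := (calO fs' J').
Implicit Types Z : covrep X.

Lemma calO_omega_surjective : surjective_rep (calO_omega w).
Proof. by apply: pull_surjective; exact: calO_surjective. Qed.

Lemma calO_omega_repR r : repR (calO_omega w) r = 0 -> ideal_set (tpI w) r.
Proof. by move=> r0; apply/rproj_eq0; exact: (@calO_repR_inj _ _ fs' J' (rproj (tpI w) r) (tp_faithful w) r0). Qed.

Lemma calO_omega_QP r :
  zspan (QPset (calO_omega w)) (repR (calO_omega w) r) <-> ideal_set (tpJ w) r.
Proof.
rewrite pull_QPset; split=> [Fr|Jr]; last first.
  by apply: calO_span; [exact: (tp_compatible w)|exists r].
(* The Fock argument only puts r in J modulo I; since I is contained in J, this suffices. *)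
have [s Js /rprojP Isr] : ideal_set J' (rproj (tpI w) r) by exact: calO_QP_sub Fr.
by rewrite -[r](subKr s); apply: idealB => //; exact: (tp_sub w).
Qed.

Lemma calO_omega_sub Z (eta : {rngmorphism calO_omega w -> Z}) :
  intertwines eta -> tpI w `<=` I_rep Z /\ tpJ w `<=` J_rep fs Z.
Proof.
move=> etaI; have [eR _ _] := etaI; split=> r.
  move=> Ir; rewrite /I_rep /= -eR /=; have -> : rproj (tpI w) r = 0 by apply/rproj_eq0.
  by rewrite !raddf0.
by move=> /calO_omega_QP Fr; apply/J_repE; rewrite -eR; exact: QPset_intertwines.
Qed.

Lemma calO_omega_lift Z : tpI w `<=` I_rep Z -> tpJ w `<=` J_rep fs Z ->
  exists eta : {rngmorphism calO_omega w -> Z}, intertwines eta.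
Proof.
move=> IZ JZ; pose Z' := covrep_desc fs (tp_inv w) IZ.
have [|eta [eR eQ eP]] := @calO_lift _ _ fs' J' Z' (tp_compatible w).
  move=> _ [r Jr <-]; rewrite desc_QPset /= descRE; apply/(J_repE fs); exact: JZ.
have [dR dQ dP] := desc_pull fs (tp_inv w) IZ.
by exists eta; split=> x; [exact: etrans (eR _) (dR x)|exact: etrans (eQ _) (dQ x)
  |exact: etrans (eP _) (dP x)].
Qed.

Section Eta.
Variables (Z : covrep X) (eta : {rngmorphism calO_omega w -> Z}).
Hypothesis etaI : intertwines eta.

Let eR r : eta (repR (calO_omega w) r) = repR Z r. Proof. by case: etaI => + _ _; apply. Qed.
Let eQ r : eta (repQ (calO_omega w) r) = repQ Z r. Proof. by case: etaI => _ + _; apply. Qed.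
Let eP r : eta (repP (calO_omega w) r) = repP Z r. Proof. by case: etaI => _ _; apply. Qed.

(** The inverse of eta is again an intertwiner, so it carries kernel elements and the span back to
    O; this gives the inclusions opposite to [calO_omega_sub]. *)
Lemma bijective_omega_rep : bijective eta ->
  (tpI w : set R, tpJ w : set R) = omega_rep fs Z.
Proof.
move=> /rngmorphism_inv[g gK Kg]; have [IZ JZ] := calO_omega_sub etaI.
have gI : intertwines g.
  by split=> x /=; rewrite -?eR -?eQ -?eP; exact: gK.
have [gR _ _] := gI.
congr pair; apply/seteqP; split=> // r.
  by move=> /= r0; apply: calO_omega_repR; rewrite -gR /= r0 raddf0.
by move=> /J_repE Fr; apply/calO_omega_QP; rewrite -gR; exact: QPset_intertwines.
Qed.

(** The shift representation built from Z inherits both inclusions of ideals, so O maps to it;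
    precomposing with the inverse of eta gives the homomorphism required by [shift_graded]. *)
Lemma bijective_graded : bijective eta -> graded_rep Z.
Proof.
move=> bij; have [IZ JZ] := calO_omega_sub etaI.
have [|r Jr|delta deltaI] := @calO_omega_lift (shift_rep Z).
- by move=> r /IZ r0; rewrite /I_rep /= /shiftR /= r0 raddf0.
- by apply/J_repE; apply: shift_QPset; apply/(J_repE fs); exact: JZ.
have sZ : surjective_rep Z.
  apply/(intertwines_surjective etaI calO_omega_surjective) => z.
  by have [g _ Kg] := bij; exists (g z).
have [g gK Kg] := rngmorphism_inv bij.
have gI : intertwines g.
  by split=> x /=; rewrite -?eR -?eQ -?eP; exact: gK.
exact: (shift_graded (delta := delta \o g) sZ (intertwines_comp gI deltaI)).
Qed.

Lemma omega_rep_bijective : surjective_rep Z -> graded_rep Z ->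
  (tpI w : set R, tpJ w : set R) = omega_rep fs Z -> bijective eta.
Proof.
move=> sZ gZ [IZ JZ].
(* The target is regarded as a representation of the quotient system through eta, because graded
   uniqueness requires sigma to be injective and this holds only over R/I. *)
pose Z' : covrep (quot_system fs (tp_inv w)) := covrep_push (Y := O) eta.
have eQP : QPset Z' = QPset Z :> set Z.
  apply/seteqP; split=> _ [a [b ->]].
    have [q <-] := projQ_surj a; have [p <-] := projP_surj b.
    by exists q, p; rewrite -eQ -eP.
  by exists (projQ fs (tp_inv w) a), (projP fs (tp_inv w) b); rewrite -eQ -eP.
have inj : injective eta.
  apply: (@graded_injective _ _ fs' O Z' eta) => //.
  - move=> a; have [r <-] := rproj_surj a => r0.
    by apply/rproj_eq0; rewrite IZ /I_rep /= -eR.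
  - move=> a; have [r <-] := rproj_surj a; rewrite eQP => Fr.
    rewrite -[QPset O]pull_QPset; apply/calO_omega_QP; rewrite JZ.
    by apply/J_repE; rewrite -eR.
  - exact: calO_surjective.
  have [G [gG GR GQ GP]] := gZ; exists G; split=> // _ [a _ <-].
  - by have [r <-] := rproj_surj a; have := GR _ (ex_intro2 _ _ r I erefl); rewrite -eR.
  - by have [r <-] := projQ_surj a; have := GQ _ (ex_intro2 _ _ r I erefl); rewrite -eQ.
  - by have [r <-] := projP_surj a; have := GP _ (ex_intro2 _ _ r I erefl); rewrite -eP.
have surj := (intertwines_surjective etaI calO_omega_surjective).1 sZ.
pose g z := sval (cid (surj z)); have Kg : cancel g eta by move=> z; exact: (svalP (cid (surj z))).
by exists g => // y; apply: inj; rewrite Kg.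
Qed.

End Eta.
End TPair.

Theorem theorem7p11 (R : rngType) (X : rsystem R) (fs : condFS X)
    (Z : covrep X) (w : tpair fs) :
  [/\ (exists eta : {rngmorphism calO_omega w -> Z}, intertwines eta) ->
        tpI w `<=` I_rep Z /\ tpJ w `<=` J_rep fs Z,
      tpI w `<=` I_rep Z -> tpJ w `<=` J_rep fs Z ->
        exists! eta : {rngmorphism calO_omega w -> Z}, intertwines eta &
      tpI w `<=` I_rep Z -> tpJ w `<=` J_rep fs Z ->
        forall eta : {rngmorphism calO_omega w -> Z}, intertwines eta ->
          (bijective eta <->
           [/\ surjective_rep Z, graded_rep Z &
               (tpI w : set R, tpJ w : set R) = omega_rep fs Z])].
Proof.
split=> [[eta etaI]|IZ JZ|_ _ eta etaI].
- exact: calO_omega_sub etaI.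
- have [eta etaI] := calO_omega_lift IZ JZ; exists eta; split=> // eta'.
  exact: (intertwines_unique (@calO_omega_surjective _ _ _ w)).
split=> [bij|[sZ gZ wE]]; last exact: omega_rep_bijective.
split; [|exact: bijective_graded bij|exact: bijective_omega_rep bij].
apply/(intertwines_surjective etaI (calO_omega_surjective _)) => z.
by have [g _ Kg] := bij; exists (g z).
Qed.
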